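(* Fix $\lambda\ge 0$, and suppose that the random variables $(X_v)_{v\in\mathbb{Z}^2}$ are non-negative, i.i.d., non-constant and have finite $(2+\varepsilon)$-th moment for some $\varepsilon>0$. Let $\boldsymbol{\lambda}=(\lambda_v)_{v\in\mathbb{Z}^2}$ with $\lambda_v=\lambda X_v$. Then, almost surely, the set $\mathcal{G}_{\boldsymbol{\lambda}}(\mathbb{Z}^2)$ of infinite-volume Gibbs measures for the hard-core model on $\mathbb{Z}^2$ with activities $\boldsymbol{\lambda}$ is a singleton.
   Context: $\mathbb{Z}^2$ denotes the graph with vertex set $\mathbb{Z}^2$ and edges between $u,v$ with $\|u-v\|_1=1$. A set $I\subseteq\mathbb{Z}^2$ is independent if no two vertices of $I$ are adjacent; $\mathcal{I}_{\mathbb{Z}^2}$ is the collection of all independent sets, viewed as a subset of $\{0,1\}^{\mathbb{Z}^2}$ with the product $\sigma$-algebra. Let $\boldsymbol{\lambda}=(\lambda_v)_{v\in\mathbb{Z}^2}$ with $0\le\lambda_v<\infty$. For finite $\Lambda\subset\mathbb{Z}^2$ and $\tau\in\mathcal{I}_{\mathbb{Z}^2}$, the hard-core measure on $\Lambda$ with boundary condition $\tau$ is the probability measure $\mu^\tau_{\Lambda,\boldsymbol{\lambda}}$ supported on $\{I\in\mathcal{I}_{\mathbb{Z}^2}: I\cap\Lambda^c=\tau\cap\Lambda^c\}$ which gives each such $I$ probability proportional to $\prod_{v\in I\cap\Lambda}\lambda_v$ (empty product equal to $1$). $\mathcal{G}_{\boldsymbol{\lambda}}(\mathbb{Z}^2)$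 is the set of probability measures $\mu$ on $\mathcal{I}_{\mathbb{Z}^2}$ satisfying the DLR conditions: for every finite $\Lambda\subset\mathbb{Z}^2$, the $\mu$-conditional law of $I\cap\Lambda$ given $I\cap\Lambda^c$ is the law of $I\cap\Lambda$ under $\mu^\tau_{\Lambda,\boldsymbol{\lambda}}$ with $\tau=I\cap\Lambda^c$. The activities are random, and the statement is that for almost every realisation of $(X_v)$ this set has exactly one element. *)

(* Defs.v *)
From HB Require Import structures.
From mathcomp Require Import all_boot all_order all_algebra.
From mathcomp Require Import finmap.
From mathcomp Require Import all_classical all_reals all_analysis measurable_realfun.

Set Implicit Arguments.
Unset Strict Implicit.
Unset Printing Implicit Defensive.

Import Order.TTheory GRing.Theory Num.Theory.

Local Open Scope classical_set_scope.
Local Open Scope ring_scope.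

Section random_variables.
Context {d : measure_display} {T : measurableType d} {R : realType}.
Variable P : probability T R.

Definition mutually_independent (I : choiceType) (X : I -> {RV P >-> R}) : Prop :=
  forall (F : {fset I}) (B : I -> set R), (forall i, measurable (B i)) ->
    P (\bigcap_(i in [set` F]) (X i @^-1` B i)) =
    (\prod_(i <- F) P (X i @^-1` B i))%E.

Definition identically_distributed (I : Type) (X : I -> {RV P >-> R}) : Prop :=
  forall (i j : I) (B : set R), measurable B ->
    distribution P (X i) B = distribution P (X j) B.

(* "Constant" is a property of the law: a version of a random variable that
   differs from a constant on a null set still counts as constant. *)
Definition as_constant (X : {RV P >-> R}) : Prop :=
  exists c : R, {ae P, forall w, X w = c}.

End random_variables.

(* [kappa] is a version of the conditional law of [Y] given [Z] under [mu]. *)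
Definition is_conditional_law {d d1 d2 : measure_display}
    {T : measurableType d} {T1 : measurableType d1} {T2 : measurableType d2}
    {R : realType} (mu : probability T R) (Y : T -> T1) (Z : T -> T2)
    (kappa : T2 -> set T1 -> \bar R) : Prop :=
  forall A : set T1, measurable A ->
    measurable_fun setT (kappa ^~ A : T2 -> \bar R) /\
    forall B : set T2, measurable B ->
      mu (Y @^-1` A `&` Z @^-1` B) =
      (\int[mu]_(w in Z @^-1` B) kappa (Z w) A)%E.

Definition Z2 : Type := (int * int)%type.
HB.instance Definition _ := Choice.on Z2.

Definition lattice_adjacent (u v : Z2) : Prop := `|u.1 - v.1| + `|u.2 - v.2| = 1.

Definition independent_set (I : set Z2) : Prop :=
  forall u v, I u -> I v -> ~ lattice_adjacent u v.

(* {0,1}^{Z^2}, seen as the subsets of Z^2, with its product sigma-algebra. *)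
Definition cylinders : set (set (set Z2)) :=
  [set [set I : set Z2 | I v] | v in [set: Z2]].

Definition config := g_sigma_algebraType cylinders.
HB.instance Definition _ := Measurable.on config.

Definition restrict_config (L : set Z2) (I : config) : config := I `&` L.

Section hard_core.
Context {R : realType}.
Variable lam : Z2 -> R.

Definition weight (L : set Z2) (I : config) : R :=
  \big[*%R/1]_(v \in I `&` L) lam v.

Definition compatible (L : set Z2) (tau : config) : set config :=
  [set I | independent_set I /\ I `\` L = tau `\` L].

(* For L finite, [compatible L tau] is finite.  The partition function is
   nonzero when tau is independent and lam is nonnegative, since then the
   configuration tau `\` L is compatible and has weight 1. *)
Definition partition_function (L : set Z2) (tau : config) : R :=
  \sum_(I \in compatible L tau) weight L I.

Definition hard_core (L : set Z2) (tau : config) (A : set config) : \bar R :=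
  ((\sum_(I \in compatible L tau `&` A) weight L I)
     / partition_function L tau)%:E.

(* Probability measures on the independent sets are the probability measures
   on {0,1}^{Z^2} giving full mass to the independent sets. *)
Definition gibbs (mu : probability config R) : Prop :=
  mu [set I | independent_set I] = 1%E /\
  forall L : set Z2, finite_set L ->
    is_conditional_law mu (restrict_config L) (restrict_config (~` L))
      (fun tau => pushforward (hard_core L tau) (restrict_config L)).

(* Measures are functions on all sets, whose values on non-measurable sets
   are irrelevant: hence uniqueness on measurable sets only. *)
Definition gibbs_singleton : Prop :=
  exists mu : probability config R, gibbs mu /\
    forall nu : probability config R, gibbs nu ->
      forall A, measurable A -> nu A = mu A.

End hard_core.

(* Main.v *)
(* Fix the boundary condition with the even, resp. odd, outer sites occupied.  Both
   measures are monotone for the order reversed on one sublattice, and the local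
   difference between them, the gap at a site, decreases with the volume; if all
   gaps tend to 0 then every local probability has a limit which does not depend on
   the boundary condition, and these limits define the only Gibbs measure.

   That the gaps tend to 0 almost surely is an Imry-Ma argument.  In a box of side l,
   the difference of the free energies of the two boundary conditions is at most the
   sum of the activities near the boundary, of mean O(l).  It increases with each
   even activity, at a rate given by the gap.  Tilt the law of the l^2 even
   activities by independent factors 1 + (sigma / l) * score, where the score favours
   large activities: the density has bounded second moment, and the tilt does not act
   on the boundary, but it raises the mean difference by sigma * l times a constant
   multiple of the mean gap.  For sigma large this is impossible unless the mean
   gap vanishes. *)

Require Import Defs.
From HB Require Import structures.
From mathcomp Require Import all_boot all_order all_algebra.
From mathcomp Require Import finmap zify ring lra.
From mathcomp Require Import all_classical all_reals all_analysis measurable_realfun.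

Set Implicit Arguments.
Unset Strict Implicit.
Unset Printing Implicit Defensive.

Import Order.TTheory GRing.Theory Num.Theory.
Import numFieldNormedType.Exports.

Local Open Scope classical_set_scope.
Local Open Scope fset_scope.
Local Open Scope ring_scope.

(** * Monotonicity in the boundary condition *)

(** Dimension two is borderline: the boundary term and the gain from the tilt are both of order l,
    so constants decide. Hence sigma is taken large, at the price of a second moment of the density
    of at most exp((sigma * K)^2), which does not depend on l.

    The obstacle is that this density is not close to 1, so the mean gap under the tilted law might
    be far smaller than the original one. Two scales resolve this. The gap in a box of fixed size k
    sees boundedly many activities, each tilted by O(1 / l), and its mean hardly moves. Replacing it
    by the gap in the large box costs little in mean, since the mean gaps decrease and are nearly
    constant from k on; a weighted Cauchy-Schwarz inequality carries this cost over to the tilted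
    law.

    Every boundary condition is encoded as a free model on the sites that it leaves unblocked.
    Comparing boundary conditions thus becomes comparing finite sets, by adding or removing one site
    at a time. *)

Definition adj (u v : Z2) : bool := `|u.1 - v.1| + `|u.2 - v.2| == 1.

Definition parity (v : Z2) : bool := odd (absz (v.1 + v.2)%R).

Definition neighbours (v : Z2) : seq Z2 :=
  [:: (v.1 + 1, v.2); (v.1 - 1, v.2); (v.1, v.2 + 1); (v.1, v.2 - 1)].

Lemma adjP (u v : Z2) : reflect (lattice_adjacent u v) (adj u v).
Proof. exact: eqP. Qed.

Lemma adjC (u v : Z2) : adj u v = adj v u.
Proof. by rewrite /adj distrC [in X in _ + X]distrC. Qed.

Lemma adjxx (u : Z2) : adj u u = false.
Proof. by case: u => a b; rewrite /adj /=; lia. Qed.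

Lemma mem_neighbours (u v : Z2) : (u \in neighbours v) = adj v u.
Proof.
case: u v => [u1 u2] [v1 v2]; rewrite /adj !inE !xpair_eqE /=.
by apply/idP/idP; lia.
Qed.

Lemma adj_parity (u v : Z2) : adj u v -> parity v = ~~ parity u.
Proof. by case: u v => [u1 u2] [v1 v2]; rewrite /adj /parity /=; lia. Qed.

Definition indep (J : {fset Z2}) : bool :=
  all (fun u => all (fun v => ~~ adj u v) J) J.

Lemma indepP (J : {fset Z2}) :
  reflect {in J &, forall u v, ~~ adj u v} (indep J).
Proof.
apply: (iffP allP) => [H u v uJ vJ|H u uJ]; first by have /allP/(_ _ vJ) := H _ uJ.
by apply/allP => v; exact: H.
Qed.

Lemma indep0 : indep fset0.
Proof. by apply/indepP. Qed.

Definition indsets (S : {fset Z2}) : {fset {fset Z2}} :=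
  [fset J in fpowerset S | indep J].

Lemma in_indsets S J : (J \in indsets S) = (J `<=` S) && indep J.
Proof. by rewrite !inE fpowersetE. Qed.

(** The sites of [S] left unblocked when [K] is occupied. Occupying [K] outside [S] turns the model
    on [S] into the free model on this subset. *)
Definition excl (S K : {fset Z2}) : {fset Z2} :=
  [fset u in S | ~~ has (adj u) K].

Lemma in_excl S K u : (u \in excl S K) = (u \in S) && ~~ has (adj u) K.
Proof. by rewrite !inE. Qed.

Lemma has_adj1 u v : has (adj u) [fset v] = adj u v.
Proof.
by apply/hasP/idP => [[x /[!inE]/eqP -> //]|uv]; exists v; rewrite ?inE.
Qed.

Lemma has_adjU u (K1 K2 : {fset Z2}) :
  has (adj u) (K1 `|` K2) = has (adj u) K1 || has (adj u) K2.
Proof.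
apply/hasP/orP => [[x /[!inE]/orP[] xK ux]|[]/hasP[x xK ux]].
- by left; apply/hasP; exists x.
- by right; apply/hasP; exists x.
- by exists x => //; rewrite inE xK.
- by exists x => //; rewrite inE xK orbT.
Qed.

Lemma indepU1 v J : v \notin J ->
  indep (v |` J) = indep J && ~~ has (adj v) J.
Proof.
move=> vJ; apply/indepP/andP => [H|[/indepP HJ /hasPn Hv] x y].
  split; first by apply/indepP => x y xJ yJ; apply: H; rewrite !inE ?xJ ?yJ orbT.
  by apply/hasPn => x xJ; apply: H; rewrite !inE ?eqxx ?xJ ?orbT.
rewrite !inE => /orP[/eqP ->|xJ] /orP[/eqP ->|yJ].
- by rewrite adjxx.
- exact: Hv.
- by rewrite adjC Hv.
- exact: HJ.
Qed.

Section partition_sums.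
Context {R : realType}.
Implicit Types (lam : Z2 -> R) (phi psi : {fset Z2} -> R) (S K J L : {fset Z2}).

Definition wt lam J : R := \prod_(v <- J) lam v.

Definition wsum lam S phi : R := \sum_(J <- indsets S) wt lam J * phi J.

Definition pf lam S : R := wsum lam S (fun=> 1).

Definition expect lam S phi : R := wsum lam S phi / pf lam S.

(** Split according to whether [v] is occupied; if it is, its neighbours are blocked and the rest is
    free. The inductions on the region below start from this recursion. *)
Lemma wsum_rec lam S phi v : v \in S ->
  wsum lam S phi = wsum lam (S `\ v) phi
    + lam v * wsum lam (excl (S `\ v) [fset v]) (fun J => phi (v |` J)).
Proof.
move=> vS; rewrite /wsum (big_fsetID _ (fun J => v \in J)) /= addrC; congr (_ + _).
  apply: eq_fbigl => J; rewrite !inE !fpowersetE /=.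
  by rewrite fsubsetD1; case: (v \in J); rewrite ?andbF ?andbT.
rewrite mulr_sumr.
have -> : [fset x | x in indsets S & v \in x] =
    [fset v |` J | J in indsets (excl (S `\ v) [fset v])].
  apply/fsetP => J; apply/idP/imfsetP => /= [|[J']].
    rewrite !inE !fpowersetE => /andP[/andP[/fsubsetP JS Ji] vJ].
    exists (J `\ v); last by rewrite fsetD1K.
    rewrite /= !inE !fpowersetE; apply/andP; split.
      apply/fsubsetP => u; rewrite in_excl has_adj1 !inE => /andP[-> uJ].
      by rewrite JS //= (indepP _ Ji).
    by apply/indepP => x y; rewrite !inE => /andP[_ xJ] /andP[_ yJ]; exact: (indepP _ Ji).
  rewrite /= !inE !fpowersetE => /andP[/fsubsetP J'S J'i] ->.
  have H u : u \in J' -> [&& u != v, u \in S & ~~ adj u v].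
    by move=> /J'S; rewrite in_excl has_adj1 !inE andbA.
  rewrite fset1U1 andbT; apply/andP; split.
    apply/fsubsetP => u; rewrite !inE => /orP[/eqP -> //|/H]; by case/and3P.
  rewrite indepU1; first by rewrite J'i; apply/hasPn => u /H /and3P[_ _]; rewrite adjC.
  by apply/negP => /H; rewrite eqxx.
rewrite big_imfset /=.
  rewrite !big_seq; apply: eq_bigr => J; rewrite in_indsets => /andP[/fsubsetP JS _].
  rewrite mulrA; congr (_ * _); rewrite /wt big_fsetU1 //.
  by apply/negP => /JS; rewrite in_excl !inE eqxx.
have nv J : J \in indsets (excl (S `\ v) [fset v]) -> v \notin J.
  rewrite in_indsets => /andP[/fsubsetP JS _].
  by apply/negP => /JS; rewrite in_excl !inE eqxx.
by move=> J1 J2 /nv J1v /nv J2v e; rewrite -(fsetU1K J1v) e fsetU1K.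
Qed.

Lemma eq_wsum lam S phi psi : {in indsets S, phi =1 psi} ->
  wsum lam S phi = wsum lam S psi.
Proof.
move=> e; rewrite /wsum !big_seq; apply: eq_bigr => J JS; by rewrite e.
Qed.

Lemma wsum_sum lam S (I : Type) (s : seq I) (phi : I -> {fset Z2} -> R) :
  wsum lam S (fun J => \sum_(i <- s) phi i J) = \sum_(i <- s) wsum lam S (phi i).
Proof.
rewrite /wsum exchange_big /=; apply: eq_bigr => J _; exact: mulr_sumr.
Qed.

Lemma wsumD lam S phi psi :
  wsum lam S (fun J => phi J + psi J) = wsum lam S phi + wsum lam S psi.
Proof. by rewrite /wsum -big_split; apply: eq_bigr => J _; rewrite mulrDr. Qed.

Lemma wsumZ lam S (a : R) phi : wsum lam S (fun J => a * phi J) = a * wsum lam S phi.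
Proof. by rewrite /wsum mulr_sumr; apply: eq_bigr => J _; rewrite mulrCA. Qed.

Lemma wsum0 lam phi : wsum lam fset0 phi = phi fset0.
Proof.
have e : indsets fset0 = [fset fset0].
  apply/fsetP => J; rewrite in_indsets !inE fsubset0.
  by case: eqP => // ->; rewrite indep0.
by rewrite /wsum e big_seq_fset1 /wt big_seq_fset0 mul1r.
Qed.

Section nonnegative_activities.
Variable lam : Z2 -> R.
Hypothesis lam_ge0 : forall v, 0 <= lam v.

Lemma wt_ge0 J : 0 <= wt lam J.
Proof. exact: prodr_ge0. Qed.

Lemma le_wsum S phi psi : {in indsets S, forall J, phi J <= psi J} ->
  wsum lam S phi <= wsum lam S psi.
Proof.
move=> e; rewrite /wsum !big_seq; apply: ler_sum => J JS.
by rewrite ler_wpM2l ?wt_ge0 ?e.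
Qed.

Lemma pf_ge1 S : 1 <= pf lam S.
Proof.
have h : fset0 \in indsets S by rewrite in_indsets fsub0set indep0.
rewrite /pf /wsum (big_fsetD1 _ h) /= mulr1 {1}/wt big_seq_fset0 lerDl.
by apply: sumr_ge0 => J _; rewrite mulr1 wt_ge0.
Qed.

Lemma pf_gt0 S : 0 < pf lam S.
Proof. exact: lt_le_trans (pf_ge1 S). Qed.

Lemma pf_neq0 S : pf lam S != 0.
Proof. by rewrite gt_eqF ?pf_gt0. Qed.

Lemma wsumE S phi : wsum lam S phi = expect lam S phi * pf lam S.
Proof. by rewrite /expect divfK ?pf_neq0. Qed.

Lemma le_expect S phi psi : {in indsets S, forall J, phi J <= psi J} ->
  expect lam S phi <= expect lam S psi.
Proof. by move=> h; rewrite /expect ler_pM2r ?invr_gt0 ?pf_gt0 ?le_wsum. Qed.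

Lemma eq_expect S phi psi : {in indsets S, phi =1 psi} -> expect lam S phi = expect lam S psi.
Proof. by move=> h; rewrite /expect (eq_wsum _ h). Qed.

Lemma expectD S phi psi :
  expect lam S (fun J => phi J + psi J) = expect lam S phi + expect lam S psi.
Proof. by rewrite /expect wsumD mulrDl. Qed.

Lemma expectZ S a phi : expect lam S (fun J => a * phi J) = a * expect lam S phi.
Proof. by rewrite /expect wsumZ mulrA. Qed.

Lemma expectN S phi : expect lam S (fun J => - phi J) = - expect lam S phi.
Proof. by rewrite -mulN1r -expectZ; apply: eq_expect => J _; rewrite mulN1r. Qed.

Lemma expect_sum S (I : Type) (s : seq I) (phi : I -> {fset Z2} -> R) :
  expect lam S (fun J => \sum_(i <- s) phi i J) = \sum_(i <- s) expect lam S (phi i).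
Proof. by rewrite /expect wsum_sum mulr_suml. Qed.

Lemma expect_cst S a : expect lam S (fun=> a) = a.
Proof.
rewrite /expect (_ : (fun=> a) = (fun J : {fset Z2} => a * 1)) ?wsumZ.
  by rewrite mulfK ?pf_neq0.
by apply/funext => J; rewrite mulr1.
Qed.

Lemma expect_ge0 S phi : {in indsets S, forall J, 0 <= phi J} -> 0 <= expect lam S phi.
Proof. by move=> h; rewrite -(expect_cst S 0); exact: le_expect. Qed.

Lemma expect_le1 S phi : {in indsets S, forall J, phi J <= 1} -> expect lam S phi <= 1.
Proof. by move=> h; rewrite -(expect_cst S 1); exact: le_expect. Qed.

(** Hard-core repulsion becomes attractive once one sublattice is flipped. Negating [b] reverses the
    order, so a result for one [b], applied to [- phi], yields the reverse inequality for the
    other. *)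
Definition below (b : bool) J J' : Prop :=
  forall v, if parity v == b then v \in J -> v \in J' else v \in J' -> v \in J.

Definition increasing (b : bool) phi : Prop :=
  forall J J', below b J J' -> phi J <= phi J'.

Lemma belowN b J J' : below b J J' -> below (~~ b) J' J.
Proof. by move=> h v; have := h v; case: (parity v); case: b {h}. Qed.

Lemma increasingN b phi : increasing b phi -> increasing (~~ b) (fun J => - phi J).
Proof.
by move=> h J J' /belowN; rewrite negbK lerN2 => /h.
Qed.

(* E_S phi is a convex combination of E_{S \ w} phi and of the expectation
   given that w is occupied; the latter is compared with the former by removing
   the neighbours of w, which have the opposite parity, from S \ w. *)
Lemma expect_fsetD1 b phi S w : increasing b phi -> w \in S -> parity w != b ->
  expect lam S phi <= expect lam (S `\ w) phi.
Proof.
have [n] := ubnP #|` S|; elim: n b phi S w => // n IH b phi S w Sn inc_phi wS wb.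
(* Sites of parity [b] are removed one by one, using the induction hypothesis for [~~ b] and
   [- phi]; this is why [b] and [phi] are generalised. *)
have shrink m (A B : {fset Z2}) : (#|` B| <= m)%N -> (m < n)%N -> A `<=` B ->
    (forall v, v \in B -> v \notin A -> parity v = b) ->
    expect lam A phi <= expect lam B phi.
  elim: m B => [|m IHm] B Bm mn AB hB.
    move: Bm; rewrite leqn0 cardfs_eq0 => /eqP B0.
    by move: AB; rewrite B0 fsubset0 => /eqP ->.
  have [BA|] := boolP (B `<=` A).
    by have -> : A = B by apply/eqP; rewrite eqEfsubset AB BA.
  case/fsubsetPn => v vB vA.
  have cB : (#|` B `\ v| < #|` B|)%N := fproper_ltn_card (fproperD1 vB).
  apply: (@le_trans _ _ (expect lam (B `\ v) phi)).
    apply: IHm.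
    - by rewrite -ltnS (leq_trans cB).
    - exact: ltnW.
    - by rewrite fsubsetD1 AB.
    - by move=> u /fsetD1P[_ uB]; exact: hB.
  have := IH (~~ b) (fun J => - phi J) B v _ (increasingN inc_phi) vB.
  rewrite !expectN lerN2; apply; first exact: leq_ltn_trans Bm mn.
  by rewrite (hB v vB vA); case: (b).
have cS : (#|` S `\ w| < #|` S|)%N := fproper_ltn_card (fproperD1 wS).
set A := excl (S `\ w) [fset w].
have h : wsum lam A (fun J => phi (w |` J)) <= expect lam (S `\ w) phi * pf lam A.
  apply: (@le_trans _ _ (wsum lam A phi)).
    apply: le_wsum => J _; apply: inc_phi => v.
    case: eqVneq => [vb|_]; last by rewrite !inE => ->; rewrite orbT.
    by rewrite !inE => /orP[/eqP e|//]; move: wb; rewrite -e vb eqxx.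
  rewrite wsumE ler_pM2r ?pf_gt0 //.
  apply: (shrink #|` S `\ w|) => //; first exact: leq_trans cS _.
    by apply/fsubsetP => v; rewrite in_excl => /andP[].
  move=> v vS; rewrite in_excl vS has_adj1 /= negbK => /adj_parity e.
  by move: wb; rewrite e; case: (parity v) (b) => -[].
rewrite {1}/expect ler_pdivrMr ?pf_gt0 // (wsum_rec _ _ wS) /pf (wsum_rec _ (fun=> 1) wS).
by rewrite mulrDr mulrCA -wsumE lerD2l ler_wpM2l.
Qed.

Lemma expect_fsubset b phi A B : increasing b phi -> A `<=` B ->
  (forall v, v \in B -> v \notin A -> parity v != b) ->
  expect lam B phi <= expect lam A phi.
Proof.
have [m] := ubnP #|` B `\` A|; elim: m B => // m IHm B Bm inc_phi AB hB.
have [BA|] := boolP (B `<=` A).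
  by have -> : A = B by apply/eqP; rewrite eqEfsubset AB BA.
case/fsubsetPn => v vB vA.
apply: le_trans (expect_fsetD1 inc_phi vB (hB _ vB vA)) _.
apply: IHm => //; last by move=> u /fsetD1P[_ uB]; exact: hB.
  rewrite fsetDDl fsetUC -fsetDDl.
  rewrite ltnS in Bm; apply: leq_trans Bm; apply: fproper_ltn_card.
  by apply: fproperD1; rewrite inE vA.
by rewrite fsubsetD1 AB.
Qed.

(** Pass through the intersection of [S] and [U]. From [S] only sites of parity other than [b] are
    lost, and on the way up to [U] only sites of parity [b] are gained; both raise the
    expectation. *)
Lemma domination b phi S U : increasing b phi ->
  (forall v, v \in S -> parity v = b -> v \in U) ->
  (forall v, v \in U -> parity v != b -> v \in S) ->
  expect lam S phi <= expect lam U phi.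
Proof.
move=> inc_phi SU US.
apply: (@le_trans _ _ (expect lam (S `&` U) phi)).
  apply: expect_fsubset inc_phi (fsubsetIl _ _) _ => v vS.
  by rewrite !inE vS /=; apply: contra => /eqP; exact: SU.
rewrite -lerN2 -!expectN.
apply: expect_fsubset (increasingN inc_phi) (fsubsetIr _ _) _ => v vU.
rewrite !inE vU andbT; apply: contra => /eqP vb; apply: US => //.
by rewrite vb; case: (b).
Qed.

Lemma pf_rec S v : v \in S ->
  pf lam S = pf lam (S `\ v) + lam v * pf lam (excl (S `\ v) [fset v]).
Proof. exact: (@wsum_rec lam S (fun=> 1)). Qed.

(** The upper bound holds because restoring [v] multiplies the partition function by at most
    [1 + lam v], hence by at most the exponential of [lam v]. *)
Lemma ln_pf_fsetD1 S v : v \in S ->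
  ln (pf lam (S `\ v)) <= ln (pf lam S) <= ln (pf lam (S `\ v)) + lam v.
Proof.
have mono A B : A `<=` B -> pf lam A <= pf lam B.
  have [m] := ubnP #|` B `\` A|; elim: m B => // m IHm B Bm AB.
  have [BA|] := boolP (B `<=` A).
    by have -> : A = B by apply/eqP; rewrite eqEfsubset AB BA.
  case/fsubsetPn => u uB uA.
  rewrite (pf_rec uB); apply: (@le_trans _ _ (pf lam (B `\ u))); last first.
    by rewrite lerDl mulr_ge0 // ltW ?pf_gt0.
  apply: IHm; last by rewrite fsubsetD1 AB.
  rewrite fsetDDl fsetUC -fsetDDl.
  rewrite ltnS in Bm; apply: leq_trans Bm; apply: fproper_ltn_card.
  by apply: fproperD1; rewrite inE uA.
move=> vS; rewrite !ler_ln ?posrE ?pf_gt0 //.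
rewrite mono ?fsubD1set //=.
rewrite -[leRHS]expRK ler_ln ?posrE ?pf_gt0 ?expR_gt0 // expRD lnK ?posrE ?pf_gt0 //.
apply: (@le_trans _ _ (pf lam (S `\ v) * (1 + lam v))); last first.
  by rewrite ler_pM2l ?pf_gt0 // expR_ge1Dx.
rewrite (pf_rec vS) mulrDr mulr1 lerD2l mulrC ler_wpM2r // mono //.
by apply/fsubsetP => u; rewrite in_excl => /andP[].
Qed.

Lemma ln_pf_fsubset A B : A `<=` B ->
  ln (pf lam A) <= ln (pf lam B) <= ln (pf lam A) + \sum_(v <- B `\` A) lam v.
Proof.
have [m] := ubnP #|` B `\` A|; elim: m B => // m IHm B Bm AB.
have [BA|] := boolP (B `<=` A).
  have -> : A = B by apply/eqP; rewrite eqEfsubset AB BA.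
  by rewrite lexx fsetDv big_seq_fset0 addr0 lexx.
case/fsubsetPn => u uB uA.
have /andP[le1 le2] := ln_pf_fsetD1 uB.
have e : (B `\ u) `\` A = (B `\` A) `\ u by rewrite fsetDDl fsetUC -fsetDDl.
have uBA : u \in B `\` A by rewrite inE uA.
have /andP[le3 le4] : ln (pf lam A) <= ln (pf lam (B `\ u)) <=
    ln (pf lam A) + \sum_(v <- (B `\ u) `\` A) lam v.
  apply: IHm; last by rewrite fsubsetD1 AB.
  rewrite e; rewrite ltnS in Bm; apply: leq_trans Bm; apply: fproper_ltn_card.
  exact: fproperD1.
rewrite (le_trans le3) //= (le_trans le2) // (big_fsetD1 _ uBA) /= -e.
by rewrite [lam u + _]addrC addrA lerD2r.
Qed.

(** Spatial Markov property in unnormalised form, obtained by peeling off the sites outside [L] with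
    [wsum_rec]. *)
Lemma wsum_markov S L phi : wsum lam S phi = wsum lam (S `\` L)
  (fun K => wsum lam (excl (S `&` L) K) (fun J => phi (K `|` J))).
Proof.
have [m] := ubnP #|` S `\` L|; elim: m S phi => // m IHm S phi Sm.
have [SL|] := boolP (S `<=` L).
  move: (SL); rewrite -fsetD_eq0 => /eqP ->; rewrite wsum0.
  have -> : excl (S `&` L) fset0 = S.
    apply/fsetP => u; rewrite in_excl !inE.
    have -> : has (adj u) fset0 = false by apply/hasP => -[].
    by rewrite andbT; case: (boolP (u \in S)) => // /(fsubsetP SL) ->.
  by apply: eq_wsum => J _; rewrite fset0U.
case/fsubsetPn => v vS vL.
have vSL : v \in S `\` L by rewrite inE vL.
have card_lt A : A `<=` (S `\` L) `\ v -> (#|` A| < m)%N.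
  move=> AS; rewrite ltnS in Sm; apply: leq_trans Sm.
  exact: leq_ltn_trans (fsubset_leq_card AS) (fproper_ltn_card (fproperD1 vSL)).
have uv u : u \in L -> u != v by apply: contraTneq => ->.
have e1 : (S `\ v) `\` L = (S `\` L) `\ v by rewrite fsetDDl fsetUC -fsetDDl.
have e2 : (S `\ v) `&` L = S `&` L.
  by apply/fsetP => u; rewrite !inE; case: (boolP (u \in L)) => [/uv ->|]; rewrite ?andbF.
have e3 : excl (S `\ v) [fset v] `\` L = excl ((S `\` L) `\ v) [fset v].
  apply/fsetP => u; rewrite !(inE, in_excl).
  by case: (u \in L) (u == v) (u \in S) => -[] [].
rewrite (wsum_rec _ _ vS) (wsum_rec _ _ vSL) IHm; last by apply: card_lt; rewrite e1.
rewrite e1 e2; congr (_ + _ * _).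
rewrite IHm ?e3; last first.
  by apply: card_lt; apply/fsubsetP => u; rewrite in_excl => /andP[].
apply: eq_wsum => K _.
have -> : excl (excl (S `\ v) [fset v] `&` L) K = excl (S `&` L) (v |` K).
  apply/fsetP => u; rewrite !(inE, in_excl) has_adjU.
  case: (boolP (u \in L)) => [/uv ->|_]; last by rewrite !andbF.
  by rewrite !andbT negb_or andbA.
by apply: eq_wsum => J _; rewrite fsetUA.
Qed.

Definition local L phi : Prop := forall J, phi (J `&` L) = phi J.

(** True conditionally on the configuration [K] outside [L]: the sites of [U] of parity other than
    [b] lie in [S] and have all their neighbours in [L], so [K] blocks none of them, and
    [domination] applies to what remains free. *)
Lemma sandwich b L S U phi : increasing b phi -> local L phi ->
  (forall v, v \in S -> v \in L -> parity v = b -> v \in U) ->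
  (forall v, v \in U -> parity v != b ->
    [&& v \in S, v \in L & all (fun u => u \in L) (neighbours v)]) ->
  expect lam S phi <= expect lam U phi.
Proof.
move=> inc_phi loc_phi SU US.
rewrite ler_pdivrMr ?pf_gt0 // /pf !(wsum_markov S L) -wsumZ; apply: le_wsum => K.
rewrite in_indsets => /andP[/fsubsetP KS _].
have KL : K `&` L = fset0.
  by apply/fsetP => u; rewrite !inE; apply/andP => -[/KS /[!inE]/andP[/negP]].
rewrite (@eq_wsum lam _ _ phi); last first.
  by move=> J _; rewrite -loc_phi fsetIUl KL fset0U loc_phi.
rewrite wsumE ler_wpM2r ?(ltW (pf_gt0 _)) //.
apply: (domination inc_phi) => v.
  by rewrite in_excl inE => /andP[/andP[vS vL] _]; exact: SU.
move=> vU /(US _ vU) /and3P[vS vL nv]; rewrite in_excl inE vS vL /=.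
apply/hasPn => u uK; apply/negP => vu.
have uL : u \in L by rewrite (allP nv) // mem_neighbours.
have : u \in K `&` L by rewrite inE uK.
by rewrite KL.
Qed.

(** * Extremal boundary conditions and the gap *)

Definition core L : {fset Z2} :=
  [fset v in L | all (fun u => u \in L) (neighbours v)].

Lemma core_adj L v u : v \in core L -> adj v u -> u \in L.
Proof. by rewrite !inE -mem_neighbours => /andP[_ /allP]; apply. Qed.

(* The hard-core measure on [L] where all outer sites of parity [b] are occupied
   is the free measure on the sites of [L] with no such neighbour. *)
Definition bd_sites L (b : bool) : {fset Z2} :=
  [fset v in L | (parity v == b) || all (fun u => u \in L) (neighbours v)].

(** [S] need not be contained in [L], so this compares volumes as well as boundary conditions. [D]
    holds sites forced to be vacant: a single site for [ratio], none for occupation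
    probabilities. *)
Lemma expect_bd_le b phi L S D : increasing b phi -> local L phi -> core L `<=` S ->
  expect lam (S `\` D) phi <= expect lam (bd_sites L b `\` D) phi.
Proof.
move=> inc_phi loc_phi /fsubsetP cLS; apply: (sandwich inc_phi loc_phi) => v.
  by rewrite !inE => /andP[-> _] -> ->; rewrite eqxx.
rewrite !inE => /andP[-> /andP[vL]] /orP[/eqP -> /eqP//|nv] _.
by rewrite vL nv andbT cLS // !inE vL.
Qed.

Lemma expect_bd_ge b phi L S D : increasing b phi -> local L phi -> core L `<=` S ->
  expect lam (bd_sites L (~~ b) `\` D) phi <= expect lam (S `\` D) phi.
Proof.
move=> inc_phi loc_phi cLS; rewrite -lerN2 -!expectN.
by apply: expect_bd_le => //; [exact: increasingN|move=> J; rewrite loc_phi].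
Qed.

Definition occ v J : R := (v \in J)%:R.

Definition vac v J : R := (~~ has (adj v) J)%:R.

(** The probability that no neighbour of [v] is occupied, given that [v] is vacant; see [ratioE].
    Unlike the occupation probability, it does not depend on [lam v]. *)
Definition ratio S v : R := pf lam (excl (S `\ v) [fset v]) / pf lam (S `\ v).

Lemma ratioE S v : ratio S v = expect lam (S `\ v) (vac v).
Proof.
congr (_ / _); rewrite /pf /wsum; set A := S `\ v.
have sub : indsets (excl A [fset v]) `<=` indsets A.
  apply/fsubsetP => J; rewrite !in_indsets => /andP[/fsubsetP JS ->].
  by rewrite andbT; apply/fsubsetP => u /JS; rewrite in_excl => /andP[].
have vacE J : J \in indsets A ->
    vac v J = (J \in indsets (excl A [fset v]))%:R.
  rewrite !in_indsets /vac => /andP[/fsubsetP JA ->]; rewrite andbT.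
  congr (_%:R); congr nat_of_bool; apply/hasPn/fsubsetP => h u uJ.
    by rewrite in_excl has_adj1 JA //= adjC h.
  by have := h u uJ; rewrite in_excl has_adj1 adjC => /andP[].
rewrite -(@big_fset_incl _ _ _ _ _ _ (fun J => wt lam J * vac v J) sub).
  by rewrite !big_seq; apply: eq_bigr => J JA; rewrite vacE ?JA // (fsubsetP sub).
by move=> J JA /negbTE nJ; rewrite vacE // nJ mulr0.
Qed.

Lemma ratio_ge0 S v : 0 <= ratio S v.
Proof. by rewrite divr_ge0 ?(ltW (pf_gt0 _)). Qed.

Lemma ratio_le1 S v : ratio S v <= 1.
Proof.
by rewrite ratioE; apply: expect_le1 => J _; rewrite /vac; case: (~~ _); rewrite ?ler01.
Qed.

Lemma expect_occ S v : v \in S ->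
  expect lam S (occ v) = lam v * ratio S v / (1 + lam v * ratio S v).
Proof.
move=> vS; rewrite /expect (pf_rec vS) (wsum_rec _ _ vS).
rewrite (@eq_wsum _ (S `\ v) _ (fun=> 0 * 1)); last first.
  move=> J; rewrite in_indsets fsubsetD1 => /andP[/andP[_ /negbTE vJ] _].
  by rewrite /occ vJ mul0r.
rewrite wsumZ mul0r add0r (@eq_wsum _ _ _ (fun=> 1)); last first.
  by move=> J _; rewrite /occ fset1U1.
rewrite -/(pf lam _) /ratio.
have Z0 := pf_gt0 (S `\ v); have Z1 := pf_gt0 (excl (S `\ v) [fset v]).
have l0 := lam_ge0 v; field.
by rewrite !gt_eqF // ltr_wpDr // mulr_ge0 // ltW.
Qed.

Lemma increasing_vac v : increasing (parity v) (vac v).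
Proof.
move=> J J' JJ'; rewrite ler_nat.
have h : has (adj v) J' -> has (adj v) J.
  move=> /hasP[u uJ' vu]; apply/hasP; exists u => //.
  by have := JJ' u; rewrite (adj_parity vu); case: (parity v) => /=; apply.
by case: (has (adj v) J') (has (adj v) J) h => -[] // /(_ isT).
Qed.

Lemma local_vac v L : (forall u, adj v u -> u \in L) -> local L (vac v).
Proof.
move=> nL J; congr (_%:R); congr (nat_of_bool (~~ _)).
apply/hasP/hasP => -[u uJ vu]; exists u => //.
  by move: uJ; rewrite inE => /andP[].
by rewrite inE uJ nL.
Qed.

Lemma ratio_bd L S v : (forall u, adj v u -> u \in L) -> core L `<=` S ->
  ratio (bd_sites L (~~ parity v)) v <= ratio S v <= ratio (bd_sites L (parity v)) v.
Proof.
move=> nL cLS; rewrite !ratioE.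
rewrite (expect_bd_le _ _ (local_vac nL)) ?(expect_bd_ge _ _ (local_vac nL)) //.
all: exact: increasing_vac.
Qed.

Lemma core_bd L b : core L `<=` bd_sites L b.
Proof. by apply/fsubsetP => v; rewrite !inE => /andP[-> ->]; rewrite orbT. Qed.

Lemma bd_sub L b : bd_sites L b `<=` L.
Proof. by apply/fsubsetP => v; rewrite !inE => /andP[]. Qed.

Lemma core_sub L L' : L `<=` L' -> core L `<=` core L'.
Proof.
move=> /fsubsetP LL'; apply/fsubsetP => v; rewrite !inE => /andP[/LL' -> /allP h].
by apply/allP => u /h /LL'.
Qed.

(** Expressed through [ratio] so as not to depend on [lam v]: it is then a fixed rate while the
    activity at [v] varies. *)
Definition gap L v : R := ratio (bd_sites L (parity v)) v - ratio (bd_sites L (~~ parity v)) v.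

Lemma gap_ge0 L v : (forall u, adj v u -> u \in L) -> 0 <= gap L v.
Proof.
by move=> nL; rewrite subr_ge0; case/andP: (ratio_bd nL (core_bd L (parity v))).
Qed.

Lemma gap_le1 L v : gap L v <= 1.
Proof. by rewrite lerBlDr (le_trans (ratio_le1 _ _)) // lerDl ratio_ge0. Qed.

(** Both boundary conditions of [L'] leave the core of [L] free, so their ratios lie between the two
    extremal ones of [L]. *)
Lemma gap_antitone L L' v : (forall u, adj v u -> u \in L) -> L `<=` L' ->
  gap L' v <= gap L v.
Proof.
move=> nL LL'.
have cL b : core L `<=` bd_sites L' b := fsubset_trans (core_sub LL') (core_bd _ _).
have /andP[_ h1] := ratio_bd nL (cL (parity v)).
have /andP[h2 _] := ratio_bd nL (cL (~~ parity v)).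
exact: lerB.
Qed.

Definition free_diff L b : R := ln (pf lam (bd_sites L b)) - ln (pf lam (bd_sites L (~~ b))).

(** Both free energies lie between that of the core and that of [L], which differ by at most the sum
    of the activities in between. *)
Lemma free_diff_bound L b : `|free_diff L b| <= \sum_(v <- L `\` core L) lam v.
Proof.
have h b' : ln (pf lam (core L)) <= ln (pf lam (bd_sites L b')) <=
    ln (pf lam (core L)) + \sum_(v <- L `\` core L) lam v.
  have /andP[-> _] := ln_pf_fsubset (core_bd L b').
  have /andP[h _] := ln_pf_fsubset (bd_sub L b'); apply: le_trans h _.
  by case/andP: (ln_pf_fsubset (fsubset_trans (core_bd L b') (bd_sub L b'))).
have /andP[h1 h2] := h b; have /andP[h3 h4] := h (~~ b).
rewrite ler_norml /free_diff; apply/andP; split; lra.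
Qed.

End nonnegative_activities.

Lemma eq_pf lam lam' S : {in S, lam =1 lam'} -> pf lam S = pf lam' S.
Proof.
move=> e; rewrite /pf /wsum !big_seq; apply: eq_bigr => J.
rewrite in_indsets => /andP[/fsubsetP JS _]; congr (_ * _).
by rewrite /wt !big_seq; apply: eq_bigr => v /JS; exact: e.
Qed.

Lemma eq_ratio lam lam' S v : {in S `\ v, lam =1 lam'} ->
  ratio lam S v = ratio lam' S v.
Proof.
move=> e; congr (_ / _); apply: eq_pf => // u.
by rewrite in_excl => /andP[uS _]; exact: e.
Qed.

Definition update lam v y : Z2 -> R := fun u => if u == v then y else lam u.

Lemma update_ge0 lam v y : 0 <= y -> (forall u, 0 <= lam u) ->
  forall u, 0 <= update lam v y u.
Proof. by move=> y0 l0 u; rewrite /update; case: ifP. Qed.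

(** The partition function is affine in the activity at [v], and [ratio] is its slope divided by its
    constant term. *)
Lemma ln_pf_update lam S v y : (forall u, 0 <= lam u) -> 0 <= y -> v \in S ->
  ln (pf (update lam v y) S) = ln (pf lam (S `\ v)) + ln (1 + y * ratio lam S v).
Proof.
move=> l0 y0 vS; rewrite (pf_rec _ vS) {2}/update eqxx.
have e A : v \notin A -> pf (update lam v y) A = pf lam A.
  move=> vA; apply: eq_pf => u uA; rewrite /update; case: eqP => // uv.
  by move: vA; rewrite -uv uA.
have Z0 := pf_gt0 l0 (S `\ v).
have Z1 : 0 <= pf lam (excl (S `\ v) [fset v]) := ltW (pf_gt0 l0 _).
rewrite !e ?in_excl ?inE ?eqxx //.
rewrite -lnM ?posrE // ?ltr_wpDr ?mulr_ge0 ?ratio_ge0 //.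
  by rewrite /ratio; congr ln; field; rewrite gt_eqF.
by rewrite invr_ge0 ltW.
Qed.

(* ln P - ln Q >= (P - Q) / P for P = (1 + y' r1) (1 + y r2) and
   Q = (1 + y r1) (1 + y' r2), whose difference is (y' - y) (r1 - r2). *)
Lemma free_diff_update lam L v y y' : (forall u, 0 <= lam u) -> 0 <= y -> y <= y' ->
  v \in core L ->
  (y' - y) / ((1 + y) * (1 + y')) * gap lam L v <=
  free_diff (update lam v y') L (parity v) - free_diff (update lam v y) L (parity v).
Proof.
move=> l0 y0 yy' vL.
have y'0 : 0 <= y' := le_trans y0 yy'.
have vbd b : v \in bd_sites L b := fsubsetP (core_bd L b) v vL.
have nL u : adj v u -> u \in L := core_adj vL.
have := gap_ge0 l0 nL; rewrite /free_diff !ln_pf_update // /gap.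
move: (ratio lam (bd_sites L (parity v)) v) (ratio lam (bd_sites L (~~ parity v)) v)
  (ratio_ge0 l0 (bd_sites L (parity v)) v)
  (ratio_ge0 l0 (bd_sites L (~~ parity v)) v) (ratio_le1 l0 (bd_sites L (parity v)) v)
  (ratio_le1 l0 (bd_sites L (~~ parity v)) v) => r1 r2 r10 r20 r11 r21 r12.
set P := (1 + y' * r1) * (1 + y * r2); set Q := (1 + y * r1) * (1 + y' * r2).
have pos a b : 0 <= a -> 0 <= b -> 0 < 1 + a * b :> R.
  by move=> a0 b0; rewrite ltr_wpDr ?mulr_ge0.
have P0 : 0 < P by rewrite mulr_gt0 ?pos.
have Q0 : 0 < Q by rewrite mulr_gt0 ?pos.
have lnP : ln P = ln (1 + y' * r1) + ln (1 + y * r2) by rewrite lnM ?posrE ?pos.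
have lnQ : ln Q = ln (1 + y * r1) + ln (1 + y' * r2) by rewrite lnM ?posrE ?pos.
have hPQ : ln Q - ln P <= Q / P - 1.
  rewrite -ln_div ?posrE //.
  have := @le_ln1Dx R (Q / P - 1); rewrite subrKC; apply.
  by rewrite ltrBrDl subrr divr_gt0.
have hP : P <= (1 + y) * (1 + y').
  rewrite [leRHS]mulrC; apply: ler_pM; [exact/ltW/pos|exact/ltW/pos| |].
    by rewrite lerD2l ler_piMr.
  by rewrite lerD2l ler_piMr.
have PQ : P - Q = (y' - y) * (r1 - r2) by rewrite /P /Q; ring.
have : (y' - y) / ((1 + y) * (1 + y')) * (r1 - r2) <= 1 - Q / P.
  have -> : 1 - Q / P = (y' - y) * (r1 - r2) / P.
    by rewrite -PQ mulrBl divff ?gt_eqF.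
  rewrite mulrAC ler_wpM2l ?mulr_ge0 ?subr_ge0 //.
    by rewrite -subr_ge0.
  by rewrite lef_pV2 ?posrE // mulr_gt0 ?ltr_wpDr.
by move: hPQ; rewrite lnP lnQ => h1 h2; lra.
Qed.

(** * Translations, boxes and the invariance of the gap *)

Definition translate (t v : Z2) : Z2 := (v.1 + t.1, v.2 + t.2).

Definition shift t S : {fset Z2} := [fset translate t v | v in S].

Lemma translate_inj t : injective (translate t).
Proof. by case: t => t1 t2 [u1 u2] [v1 v2] [] /addIr -> /addIr ->. Qed.

Lemma translateK t u : translate t (translate (- t.1, - t.2) u) = u.
Proof. by case: t u => t1 t2 [u1 u2]; rewrite /translate /= !subrK. Qed.

Lemma adj_translate t u v : adj (translate t u) (translate t v) = adj u v.
Proof.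
have e (a b c : int) : a + c - (b + c) = a - b by lia.
by rewrite /adj /= !e.
Qed.

Lemma parity_translate t v : parity (translate t v) = parity v (+) parity t.
Proof. by case: t v => t1 t2 [v1 v2]; rewrite /parity /translate /=; lia. Qed.

Lemma mem_shift t S u : (translate t u \in shift t S) = (u \in S).
Proof. by rewrite mem_imfset //; exact: translate_inj. Qed.

Lemma shift_eqP t S S' : (forall u, (translate t u \in S') = (u \in S)) -> S' = shift t S.
Proof. by move=> h; apply/fsetP => u; rewrite -[u](translateK t) h mem_shift. Qed.

Lemma shift_fsetD1 t S v : shift t S `\ translate t v = shift t (S `\ v).
Proof.
by apply: shift_eqP => u; rewrite !in_fsetD1 mem_shift (inj_eq (@translate_inj t)).
Qed.

Lemma shift_excl1 t S v : excl (shift t S) [fset translate t v] = shift t (excl S [fset v]).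
Proof.
by apply: shift_eqP => u; rewrite !in_excl mem_shift !has_adj1 adj_translate.
Qed.

Lemma neighbours_translate t v : neighbours (translate t v) = map (translate t) (neighbours v).
Proof.
case: t v => t1 t2 [v1 v2]; rewrite /neighbours /translate /=.
by rewrite !(addrAC _ t1) !(addrAC _ t2).
Qed.

Lemma shift_bd t L b : bd_sites (shift t L) b = shift t (bd_sites L (b (+) parity t)).
Proof.
apply: shift_eqP => u; rewrite !inE mem_shift neighbours_translate all_map parity_translate.
congr (_ && (_ || _)); first by case: (parity u) (parity t) b => -[] [].
by apply: eq_all => w /=; rewrite mem_shift.
Qed.

Lemma pf_shift t lam S : pf lam (shift t S) = pf (lam \o translate t) S.
Proof.
have [m] := ubnP #|` S|; elim: m S => // m IHm S Sm.
have [->|[v vS]] := fset_0Vmem S; first by rewrite /shift imfset0 /pf !wsum0.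
have lt A : A `<=` S `\ v -> (#|` A| < m)%N.
  move=> AS; rewrite ltnS in Sm; apply: leq_trans Sm.
  exact: leq_ltn_trans (fsubset_leq_card AS) (fproper_ltn_card (fproperD1 vS)).
rewrite (pf_rec _ vS) (@pf_rec _ _ (translate t v)) ?mem_shift //.
rewrite shift_fsetD1 shift_excl1 !IHm //; apply: lt => //.
by apply/fsubsetP => u; rewrite in_excl => /andP[].
Qed.

Lemma ratio_shift t lam S v :
  ratio lam (shift t S) (translate t v) = ratio (lam \o translate t) S v.
Proof. by rewrite /ratio shift_fsetD1 shift_excl1 !pf_shift. Qed.

(** An odd translation exchanges the two boundary conditions but also the parity of the site; as the
    gap is taken relative to that parity, it is unchanged. *)
Lemma gap_shift t lam L v : gap lam (shift t L) (translate t v) = gap (lam \o translate t) L v.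
Proof.
rewrite /gap !shift_bd !ratio_shift parity_translate.
by rewrite -addbA addbb addbF addNb -addbA addbb addbF.
Qed.

Definition box (c : Z2) (k : nat) : {fset Z2} :=
  [fset ((c.1 + i%:Z - k%:Z, c.2 + j%:Z - k%:Z) : Z2)
    | i in iota 0 k.*2.+1, j in iota 0 k.*2.+1].

Lemma in_box c k u : (u \in box c k) = (`|u.1 - c.1| <= k%:Z) && (`|u.2 - c.2| <= k%:Z).
Proof.
case: c u => c1 c2 [u1 u2].
have mem m n : in_mem m (mem_fin (fin_finpred (iota 0 n))) = (m < n)%N.
  by rewrite -[LHS]/(m \in iota 0 n) mem_iota.
have memI m n : (m < n)%N -> in_mem m (mem_fin (fin_finpred (iota 0 n))).
  by rewrite mem.
apply/imfset2P/andP => [[i + [j]]|[h1 h2]].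
  by rewrite !mem => hi hj [-> ->] /=; split; lia.
move: h1 h2 => /= h1 h2; exists (absz (u1 - c1 + k%:Z)); first by apply: (@memI _ k.*2.+1); lia.
exists (absz (u2 - c2 + k%:Z)); first by apply: (@memI _ k.*2.+1); lia.
by congr pair; lia.
Qed.

Lemma shift_box t c k : shift t (box c k) = box (translate t c) k.
Proof.
apply/esym/shift_eqP => u; rewrite !in_box /=.
have e (a b d : int) : a + d - (b + d) = a - b by lia.
by rewrite !e.
Qed.

(** The radius is [k.+1] so that the neighbours of [v] belong to the box even for [k = 0]. *)
Definition gap_box lam v k : R := gap lam (box v k.+1) v.

Lemma gap_box_shift lam v k : gap_box lam v k = gap_box (lam \o translate v) (0, 0) k.
Proof.
have e : v = translate v (0, 0) by case: v => v1 v2; rewrite /translate /= !add0r.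
transitivity (gap lam (box (translate v (0, 0)) k.+1) (translate v (0, 0))).
  by rewrite -e.
by rewrite -shift_box gap_shift.
Qed.

Lemma adj_box v k u : adj v u -> u \in box v k.+1.
Proof. by case: v u => v1 v2 [u1 u2]; rewrite /adj in_box /=; lia. Qed.

Lemma box_sub c c' k k' : `|c.1 - c'.1| + k%:Z <= k'%:Z ->
  `|c.2 - c'.2| + k%:Z <= k'%:Z -> box c k `<=` box c' k'.
Proof.
move=> h1 h2; apply/fsubsetP => u; rewrite !in_box => /andP[h3 h4].
have dist (x y z : int) : `|x - y| <= k%:Z -> `|y - z| + k%:Z <= k'%:Z ->
  `|x - z| <= k'%:Z by lia.
by rewrite (dist _ _ _ h3 h1) (dist _ _ _ h4 h2).
Qed.

Lemma gap_box_antitone lam v k k' : (forall u, 0 <= lam u) -> (k <= k')%N ->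
  gap_box lam v k' <= gap_box lam v k.
Proof.
move=> l0 kk'; apply: gap_antitone => //; first exact: adj_box.
by apply: box_sub; rewrite subrr normr0 add0r lez_nat ltnS.
Qed.

Lemma gap_box_ge0 lam v k : (forall u, 0 <= lam u) -> 0 <= gap_box lam v k.
Proof. by move=> l0; apply: gap_ge0 => // u; exact: adj_box. Qed.

Lemma core_box c k : core (box c k.+1) = box c k.
Proof.
apply/fsetP => u; rewrite !inE /= !in_box /=; case: c u => c1 c2 [u1 u2] /=.
by apply/idP/idP; lia.
Qed.

End partition_sums.

(** * From the gap to arbitrary local functions *)

Section comparison.
Context {R : realType}.
Variable lam : Z2 -> R.
Hypothesis lam_ge0 : forall v, 0 <= lam v.
Implicit Types (phi : {fset Z2} -> R) (S K J L F : {fset Z2}).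

(** The map t / (1 + t), which sends [lam v] times the ratio to the occupation probability, has
    slope at most 1 for t >= 0. *)
Lemma occ_gap L v : v \in core L ->
  expect lam (bd_sites L (parity v)) (occ v) - expect lam (bd_sites L (~~ parity v)) (occ v)
  <= lam v * gap lam L v.
Proof.
move=> vL; have vbd b : v \in bd_sites L b := fsubsetP (core_bd L b) v vL.
have nL u : adj v u -> u \in L := core_adj vL.
have := gap_ge0 lam_ge0 nL; rewrite /gap !expect_occ //.
move: (ratio lam (bd_sites L (parity v)) v) (ratio lam (bd_sites L (~~ parity v)) v)
  (ratio_ge0 lam_ge0 (bd_sites L (parity v)) v)
  (ratio_ge0 lam_ge0 (bd_sites L (~~ parity v)) v) => r1 r2 r10 r20 r12.
have l0 := lam_ge0 v.
have p1 : 0 <= lam v * r1 by rewrite mulr_ge0.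
have p2 : 0 <= lam v * r2 by rewrite mulr_ge0.
have -> : lam v * r1 / (1 + lam v * r1) - lam v * r2 / (1 + lam v * r2) =
  lam v * (r1 - r2) / ((1 + lam v * r1) * (1 + lam v * r2)).
  by field; rewrite !gt_eqF // ltr_wpDr.
rewrite ler_pdivrMr ?mulr_gt0 ?ltr_wpDr //.
rewrite ler_peMr ?mulr_ge0 // mulrDl mul1r -addrA lerDl.
by rewrite addr_ge0 ?mulr_ge0 // addr_ge0.
Qed.

Lemma increasing_occ v : increasing (parity v) (occ v : {fset Z2} -> R).
Proof.
move=> J J' /(_ v); rewrite eqxx ler_nat => h.
by case: (boolP (v \in J)) => // /h ->.
Qed.

Lemma local_occ v L : v \in L -> local L (occ v : {fset Z2} -> R).
Proof. by move=> vL J; rewrite /occ inE vL andbT. Qed.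

Lemma sub_local F L phi : F `<=` L -> local F phi -> local L phi.
Proof.
move=> /fsubsetP FL loc J; rewrite -loc -[RHS]loc; congr phi.
by apply/fsetP => u; rewrite !inE; case: (boolP (u \in F)) => [/FL ->|]; rewrite ?andbT ?andbF.
Qed.

(* Applied with e = 1 and e = -1, this extends the monotone comparison of
   boundary conditions to arbitrary local functions. *)
Lemma increasing_comp (e : R) b F phi : `|e| <= 1 -> local F phi ->
  (forall J, 0 <= phi J <= 1) ->
  increasing b (fun J => \sum_(v <- F) (if parity v == b then 1 else -1) * occ v J
                         + e * phi J).
Proof.
move=> e1 loc phi01 J J' JJ'.
have le v : (if parity v == b then 1 else -1) * occ v J <=
    (if parity v == b then 1 else -1) * occ v J' :> R.
  have := JJ' v; rewrite /occ; case: eqP => _ h.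
    by rewrite !mul1r ler_nat; case: (v \in J) h => // ->.
  by rewrite !mulN1r lerN2 ler_nat; case: (v \in J') h => // ->.
(* Either [J] and [J'] agree on [F] and [phi] does not change, or some site of [F] contributes an
   increase of 1 to the signed sum, which covers any loss of [e * phi]. *)
have [eqF|] := boolP (all (fun v => (v \in J) == (v \in J')) F).
  have -> : phi J = phi J'.
    rewrite -loc -[RHS]loc; congr phi; apply/fsetP => v; rewrite !inE.
    by case: (boolP (v \in F)) => [vF|]; rewrite ?andbF // (eqP (allP eqF v vF)).
  by rewrite lerD2r; apply: ler_sum => v _.
case/allPn => v vF neq.
rewrite !(big_fsetD1 _ vF) /=.
have lesum : \sum_(u <- F `\ v) (if parity u == b then 1 else -1) * occ u J <=
    \sum_(u <- F `\ v) (if parity u == b then 1 else -1) * occ u J' :> R.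
  by apply: ler_sum => u _.
have one : (if parity v == b then 1 else -1) * occ v J + 1 <=
    (if parity v == b then 1 else -1) * occ v J' :> R.
  have := JJ' v; move: neq; rewrite /occ; case: (parity v == b).
    by case: (v \in J) (v \in J') => -[] // _ h; [have := h isT|rewrite !mul1r add0r].
  case: (v \in J) (v \in J') => -[] // _ h; last by have := h isT.
  by rewrite mulr1 mulr0 addNr.
suff ephi : e * phi J <= e * phi J' + 1.
  have key (x x' s s' p p' : R) : x + 1 <= x' -> s <= s' -> p <= p' + 1 ->
    x + s + p <= x' + s' + p' by move=> *; lra.
  exact: key one lesum ephi.
have /andP[a0 a1] := phi01 J; have /andP[c0 c1] := phi01 J'.
rewrite -lerBlDl -mulrBr.
apply: le_trans (ler_norm _) _; rewrite normrM -[leRHS]mulr1.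
by apply: ler_pM => //; rewrite ler_norml; lra.
Qed.

(** The extremal measure dominates that of [S] on the increasing functions of [increasing_comp].
    Hence the difference for [phi], with either sign, is at most the sum over [F] of the differences
    of occupation probabilities, which [occ_gap] bounds. *)
Lemma local_estimate b L F S phi : F `<=` core L -> core L `<=` S ->
  local F phi -> (forall J, 0 <= phi J <= 1) ->
  `|expect lam S phi - expect lam (bd_sites L b) phi| <= \sum_(v <- F) lam v * gap lam L v.
Proof.
move=> FL LS loc phi01.
have FcL v : v \in F -> v \in core L by move/(fsubsetP FL).
have coreL : core L `<=` L by apply/fsubsetP => v; rewrite inE => /andP[].
have FL' : F `<=` L := fsubset_trans FL coreL.
pose sg v : R := if parity v == b then 1 else -1.
have bound e : `|e| <= 1 ->
    e * (expect lam S phi - expect lam (bd_sites L b) phi) <= \sum_(v <- F) lam v * gap lam L v.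
  move=> e1; pose h J := \sum_(v <- F) sg v * occ v J + e * phi J.
  have loch : local L h.
    move=> J; rewrite /h (sub_local FL' loc); congr (_ + _).
    rewrite !big_seq; apply: eq_bigr => v vF.
    by rewrite local_occ // (fsubsetP FL').
  have := expect_bd_le lam_ge0 fset0 (@increasing_comp e b F phi e1 loc phi01) loch LS.
  rewrite !fsetD0 !expectD // !expectZ // !expect_sum.
  under eq_bigr do rewrite expectZ; under [in leRHS]eq_bigr do rewrite expectZ.
  have : \sum_(v <- F) sg v * expect lam (bd_sites L b) (occ v) -
      \sum_(v <- F) sg v * expect lam S (occ v) <= \sum_(v <- F) lam v * gap lam L v.
    rewrite -sumrB !big_seq; apply: ler_sum => v vF.
    apply: le_trans (occ_gap (FcL v vF)).
    have lv := local_occ (fsubsetP FL' v vF).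
    have := expect_bd_le lam_ge0 fset0 (@increasing_occ v) lv LS.
    have := expect_bd_ge lam_ge0 fset0 (@increasing_occ v) lv LS.
    rewrite !fsetD0 -mulrBr /sg; case: eqP => [->|/eqP vb]; first lra.
    have <- : ~~ parity v = b by clear -vb; case: (parity v) b vb => -[].
    lra.
  rewrite -/(sg _); lra.
rewrite ler_norml; apply/andP; split.
  have := bound (-1); rewrite normrN1 => /(_ (lexx _)); lra.
have := bound 1; rewrite normr1 => /(_ (lexx _)); lra.
Qed.

Lemma core_sub_self L : core L `<=` L.
Proof. by apply/fsubsetP => v; rewrite inE => /andP[]. Qed.

End comparison.

Local Open Scope classical_set_scope.
Local Open Scope ring_scope.

(** * Existence and uniqueness of the Gibbs measure when the gaps vanish *)

Definition depends_on (F : {fset Z2}) (C : set config) : Prop :=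
  forall I I' : config, (forall v, v \in F -> I v <-> I' v) -> C I -> C I'.

Lemma depends_onI F F' C C' : depends_on F C -> depends_on F' C' ->
  depends_on (F `|` F')%fset (C `&` C').
Proof.
move=> h h' I I' II' [CI CI']; split.
  by apply: (h I) => // v vF; apply: II'; rewrite inE vF.
by apply: (h' I) => // v vF; apply: II'; rewrite inE vF orbT.
Qed.

Lemma depends_onC F C : depends_on F C -> depends_on F (~` C).
Proof.
by move=> h I I' II' nCI CI'; apply: nCI; apply: (h I') => // v vF; split=> /(II' v vF).
Qed.

Lemma depends_onT : depends_on fset0 setT.
Proof. by []. Qed.

Lemma depends_on1 v : depends_on [fset v] [set I | I v].
Proof. by move=> I I' II' /= /II'; apply; rewrite inE. Qed.

Lemma measurable_site v : measurable [set I : config | I v].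
Proof. by apply: sub_sigma_algebra; exists v. Qed.

Lemma measurable_pattern (F K : {fset Z2}) :
  measurable [set I : config | forall v, v \in F -> I v <-> v \in K].
Proof.
have -> : [set I : config | forall v, v \in F -> I v <-> v \in K] =
   \bigcap_(v in [set` F]) (if v \in K then [set I : config | I v] else ~` [set I | I v]).
  apply/seteqP; split => [I h v /= vF|I h v vF].
    by have := h v vF; case: (v \in K) => -[h1 h2]; [exact: h2|move=> /h1].
  by have := h v vF; case: (v \in K) => /= ?; split.
apply: fin_bigcap_measurable; first exact: finite_fset.
move=> v _; case: ifP => _; first exact: measurable_site.
by apply: measurableC; exact: measurable_site.
Qed.

Lemma trace_pattern (F : {fset Z2}) (I : set Z2) v : v \in F ->
  I v <-> v \in [fset u in F | `[< I u >]].
Proof. by move=> vF; rewrite !inE vF /=; split=> /asboolP. Qed.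

Lemma depends_on_measurable F C : depends_on F C -> measurable C.
Proof.
move=> h; have -> : C = \bigcup_(K in [set` [fset K in fpowerset F | `[< C [set` K] >]]])
    [set I : config | forall v, v \in F -> I v <-> v \in K].
  apply/seteqP; split => [I CI|I [K /=]].
    exists [fset u in F | `[< I u >]]; last by move=> v; exact: trace_pattern.
    rewrite /= !inE fpowersetE; apply/andP; split.
      by apply/fsubsetP => u; rewrite inE => /andP[].
    by apply/asboolP; apply: (h I) => // v vF; exact: trace_pattern.
  rewrite !inE => /andP[_ /asboolP CK] IK; apply: (h [set` K]) => // v vF.
  by rewrite /= IK.
apply: fin_bigcup_measurable; first exact: finite_fset.
by move=> K _; exact: measurable_pattern.
Qed.

(** An enumeration with possible repetitions, since codes of no site go to the origin. This is
    harmless: a word that gives two values to the same site has an empty cylinder, of mass 0. *)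
Definition site (i : nat) : Z2 := odflt (0, 0) (@choice.unpickle (int * int)%type i).

Definition rank (v : Z2) : nat := @choice.pickle (int * int)%type v.

Lemma rankK v : site (rank v) = v.
Proof. by rewrite /site /rank choice.pickleK. Qed.

Definition cyl (w : seq bool) : set config :=
  [set I | forall i, (i < size w)%N -> I (site i) <-> nth false w i].

Lemma cyl_nil : cyl [::] = setT.
Proof. by apply/seteqP; split. Qed.

Lemma cyl_rcons w b :
  cyl (rcons w b) = cyl w `&` [set I | I (site (size w)) <-> b].
Proof.
apply/seteqP; split => [I h|I [h /= hb] i].
  split => [i iw|].
    by have := h i; rewrite size_rcons nth_rcons iw; apply; exact: ltnW.
  by have := h (size w); rewrite size_rcons nth_rcons ltnn eqxx; apply.
rewrite size_rcons ltnS leq_eqVlt nth_rcons => /orP[/eqP ->|iw].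
  by rewrite ltnn eqxx.
by rewrite iw; exact: h.
Qed.

Lemma depends_on_cyl w : depends_on [fset site i | i in iota 0 (size w)] (cyl w).
Proof.
move=> I I' II' h i iw; rewrite -h //; apply: iff_sym; apply: II'.
by apply: in_imfset; rewrite /= mem_iota.
Qed.

(* Kolmogorov extension on {0,1}^{Z^2}: the cylinder of each finite word is
   sent to a subinterval of [0, 1[ of the prescribed length, nested along
   prefixes, and Lebesgue measure is pushed forward by the coding map. *)
Section extension.
Context {R : realType}.
Variable l : set config -> R.
Hypothesis l_ge0 : forall F C, depends_on F C -> 0 <= l C.
Hypothesis lT : l setT = 1.
Hypothesis lD : forall F C C', depends_on F C -> depends_on F C' ->
  C `&` C' = set0 -> l (C `|` C') = l C + l C'.

Let mass w := l (cyl w).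

(** Left end of the interval of the prefix of length [k]. Within the interval of a word, the
    extension by [false] takes the left part, and the extension by [true] is shifted by the mass of
    its sibling. *)
Fixpoint left_end (w : seq bool) (k : nat) : R :=
  if k isn't k'.+1 then 0 else
  left_end w k' + if nth false w k' then mass (rcons (take k' w) false) else 0.

Let left w := left_end w (size w).

Lemma left_rcons w b :
  left (rcons w b) = left w + if b then mass (rcons w false) else 0.
Proof.
have e k : (k <= size w)%N -> left_end (rcons w b) k = left_end w k.
  elim: k => //= k IH kw; rewrite IH 1?ltnW // nth_rcons kw.
  by rewrite -[in take k _]cats1 takel_cat // ltnW.
rewrite /left size_rcons /= e // nth_rcons ltnn eqxx.
by rewrite -[in take _ _]cats1 take_size_cat.
Qed.

Lemma l_split F C w : depends_on F C ->
  l (C `&` cyl w) = l (C `&` cyl (rcons w false)) + l (C `&` cyl (rcons w true)).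
Proof.
move=> hC; rewrite -(@lD (F `|` [fset site i | i in iota 0 (size w).+1])%fset).
- rewrite -setIUr; congr (l (_ `&` _)); rewrite !cyl_rcons -setIUr.
  apply/seteqP; split => [I cI|I []//]; split => //=.
  by have [h|h] := pselect (I (site (size w))); [right|left].
- by apply: depends_onI => //; have := @depends_on_cyl (rcons w false); rewrite size_rcons.
- by apply: depends_onI => //; have := @depends_on_cyl (rcons w true); rewrite size_rcons.
- apply/seteqP; split => // I [[_]]; rewrite !cyl_rcons => -[_ /= h] [_ [_ /= h']].
  by move: h'; rewrite h => -[_ /(_ isT)].
Qed.

Lemma l0 : l set0 = 0.
Proof.
have := lD depends_onT (depends_onC depends_onT); rewrite setCT setI0 setU0.
by move=> /(_ erefl); lra.
Qed.

Lemma mass_ge0 w : 0 <= mass w.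
Proof. exact: l_ge0 (@depends_on_cyl w). Qed.

Lemma mass_rcons w : mass w = mass (rcons w false) + mass (rcons w true).
Proof. by have := @l_split _ _ w depends_onT; rewrite !setTI. Qed.

Let threshold w := left w + mass (rcons w false).

(** The address of [u]: for [u] in [0, 1[, the word of length [n] whose interval contains [u]. *)
Fixpoint word (u : R) (n : nat) : seq bool :=
  if n isn't n'.+1 then [::] else
  let w := word u n' in rcons w (threshold w <= u).

Lemma size_word u n : size (word u n) = n.
Proof. by elim: n => //= n IH; rewrite size_rcons IH. Qed.

Lemma take_word u m n : (m <= n)%N -> take m (word u n) = word u m.
Proof.
elim: n => [|n IH]; first by rewrite leqn0 => /eqP ->.
rewrite leq_eqVlt => /orP[/eqP ->|mn] /=.
  by rewrite -[X in take X](size_word u n.+1) take_size.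
by rewrite -cats1 takel_cat ?size_word // IH.
Qed.

Lemma left_in_itv u n : 0 <= u < 1 ->
  left (word u n) <= u < left (word u n) + mass (word u n).
Proof.
move=> u01; elim: n => [|n /andP[IH1 IH2]] /=.
  by rewrite /left /= add0r /mass cyl_nil lT.
rewrite left_rcons; case: (leP (threshold _) u) => hu.
  by rewrite -addrA -mass_rcons IH2 andbT.
by rewrite addr0 IH1.
Qed.

Lemma word_uniq u w : 0 <= u < 1 -> left w <= u < left w + mass w ->
  word u (size w) = w.
Proof.
move=> u01; elim/last_ind: w => // w b IH.
rewrite left_rcons size_rcons /= => /andP[h1 h2].
have m0 := mass_ge0 (rcons w false); have m1 := mass_ge0 (rcons w true).
have mw := mass_rcons w.
have wu : word u (size w) = w by apply: IH; apply/andP; split; case: b h1 h2; lra.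
rewrite wu; congr rcons; rewrite /threshold; case: b h1 h2 => h1 h2.
  by rewrite h1.
by apply/negbTE; rewrite -ltNge; lra.
Qed.

Lemma word_preimage w : [set u | word u (size w) = w] `&` `[0, 1[ =
  `[left w, left w + mass w[ `&` `[0, 1[.
Proof.
apply/seteqP; split => u [h /=]; rewrite in_itv /= => u01; split => //=.
  by rewrite in_itv /=; have := left_in_itv (size w) u01; rewrite h.
by apply: word_uniq => //; move: h; rewrite /= in_itv.
Qed.

Lemma word_rcons u w b :
  word u (size (rcons w b)) = rcons w b <->
  word u (size w) = w /\ (threshold w <= u) = b.
Proof.
rewrite size_rcons /=; split => [/rcons_inj[-> ->]|[-> ->]] //.
Qed.

Local Arguments word u n : simpl never.

Lemma measurable_word w : measurable ([set u | word u (size w) = w] : set R).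
Proof.
elim/last_ind: w => [|w b IH].
  by rewrite [X in measurable X](_ : _ = setT) //; apply/seteqP; split.
rewrite [X in measurable X](_ : _ = [set u | word u (size w) = w] `&`
    (if b then [set` `[threshold w, +oo[] else ~` [set` `[threshold w, +oo[])); last first.
  apply/seteqP; split => u.
    move=> /word_rcons[wu h]; split => //.
    by case: b h => h /=; rewrite in_itv /= andbT h.
  move=> [wu h]; apply/word_rcons; split => //.
  by case: b h => /=; rewrite in_itv /= andbT // => /negP/negbTE.
apply: measurableI => //; case: b; first exact: measurable_itv.
by apply: measurableC; exact: measurable_itv.
Qed.

Definition coding (u : R) : config := [set v | nth false (word u (rank v).+1) (rank v)].

Lemma measurable_coding : measurable_fun setT (coding : R -> config).
Proof.
apply: (@measurability _ _ R config setT coding cylinders) => //.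
move=> _ [_ [v _ <-] <-]; rewrite setTI.
rewrite [X in measurable X](_ : _ =
  \bigcup_(w in [set w : (rank v).+1.-tuple bool | nth false w (rank v)])
   [set u : R | word u (size w) = w]).
  apply: fin_bigcup_measurable; first exact: finite_finset.
  by move=> w _; exact: measurable_word.
apply/seteqP; split => u /=; rewrite /coding /=.
  move=> h; have sw : size (word u (rank v).+1) == (rank v).+1 by rewrite size_word.
  by exists (Tuple sw) => //=; rewrite size_word.
by move=> [w /= hw]; rewrite size_tuple => ->.
Qed.

Lemma left_mass_bounds w : 0 <= left w /\ left w + mass w <= 1.
Proof.
elim/last_ind: w => [|w b [h1 h2]].
  by rewrite /left /mass /= cyl_nil lT add0r.
rewrite left_rcons; have m0 := mass_ge0 (rcons w false).
have m1 := mass_ge0 (rcons w true); have mw := mass_rcons w.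
by case: b; split; lra.
Qed.

Let cell w : set R := [set u | word u (size w) = w] `&` `[0, 1[.

Lemma measurable_cell w : measurable (cell w).
Proof. by apply: measurableI; [exact: measurable_word|exact: measurable_itv]. Qed.

Lemma lebesgue_cell w : lebesgue_measure (cell w) = (mass w)%:E.
Proof.
rewrite /cell word_preimage setIidl; last first.
  have [h1 h2] := left_mass_bounds w.
  by move=> u /=; rewrite !in_itv /= => /andP[h3 h4]; apply/andP; split; lra.
rewrite lebesgue_measure_itv /= lte_fin; case: ltP => [_|].
  by rewrite -EFinD addrAC subrr add0r.
have := mass_ge0 w => m0 h; congr EFin; lra.
Qed.

(** A word longer than the rank of every site of [F] decides [C], both on its cell and on its
    cylinder. Shorter words follow by splitting into their two extensions; [m] counts the missing
    letters. *)
Lemma lebesgue_coding F C w n m : depends_on F C ->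
  (forall v, v \in F -> rank v < n)%N -> (size w + m)%N = n ->
  lebesgue_measure (cell w `&` coding @^-1` C) = (l (C `&` cyl w))%:E.
Proof.
move=> hC Fn; have mC : measurable (coding @^-1` C : set R).
  rewrite -[X in measurable X]setTI.
  exact: measurable_coding measurableT _ (depends_on_measurable hC).
elim: m w => [|m IH] w wn.
  rewrite addn0 in wn.
  have cellE u : cell w u -> forall v, v \in F -> coding u v <-> nth false w (rank v).
    move=> [/= wu _] v /Fn vn; rewrite /coding /= -(@take_word u _ n) //.
    by rewrite -{1}wn wu nth_take.
  have cylE I : cyl w I -> forall v, v \in F -> I v <-> nth false w (rank v).
    by move=> h v /Fn vn; rewrite -{1}[v]rankK; apply: h; rewrite wn.
  pose I0 : config := [set v | nth false w (rank v)].
  have [CI0|nCI0] := pselect (C I0).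
    rewrite setIidl; last first.
      by move=> u cu; have h := cellE u cu; apply: (hC I0) => // v vF; apply: iff_sym; exact: h.
    rewrite lebesgue_cell setIidr // => I cI; have h := cylE I cI.
    by apply: (hC I0) => // v vF; apply: iff_sym; exact: h.
  rewrite [X in lebesgue_measure X](_ : _ = set0); last first.
    by apply/seteqP; split => // u [cu Cu]; apply: nCI0; apply: (hC _ _ (cellE u cu)).
  rewrite measure0 [X in l X](_ : _ = set0) ?l0 //.
  by apply/seteqP; split => // I [CI cI]; apply: nCI0; apply: (hC _ _ (cylE I cI)).
have -> : cell w = cell (rcons w false) `|` cell (rcons w true).
  apply/seteqP; split => u.
    move=> [wu u01]; case: (boolP (threshold w <= u)) => hu; [right|left];
      by split => //; apply/word_rcons; split => //; exact/negbTE.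
  by move=> [] [/word_rcons[wu _] u01].
rewrite setIUl measureU; first last.
- apply/seteqP; split => // u [[[/word_rcons[_ h1] _] _] [[/word_rcons[_ h2] _] _]].
  by move: h1; rewrite h2.
- by apply: measurableI => //; exact: measurable_cell.
- by apply: measurableI => //; exact: measurable_cell.
by rewrite (l_split _ hC) EFinD; congr (_ + _)%E; apply: IH; rewrite size_rcons addSnnS.
Qed.

Let m01 : measurable (`[0%R, 1[ : set R) := measurable_itv _.

Let nu : {measure set config -> \bar R} :=
  measure_function_pushforward__canonical__measure_function_Measure
    (mrestr lebesgue_measure m01) measurable_coding.

Theorem extension : exists mu : probability config R,
  forall F C, depends_on F C -> mu C = (l C)%:E.
Proof.
have nuE F C : depends_on F C -> nu C = (l C)%:E.
  move=> hC; pose n := (\max_(v <- F) (rank v).+1)%N.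
  have := @lebesgue_coding F C [::] n n hC; rewrite cyl_nil setIT => <- //.
    rewrite /nu /= /pushforward /mrestr /cell setIC; congr lebesgue_measure.
    by congr (_ `&` _); rewrite setIidr.
  move=> v vF; exact: (leq_bigmax_seq (F := fun v => (rank v).+1)).
have nuT : nu setT = 1%E by rewrite (nuE _ _ depends_onT) lT.
(* Since [nu] has mass 1, normalising leaves it unchanged and only gives it the type of a
   probability; the Dirac mass is the default value for a null or infinite measure. *)
exists (mnormalize nu (@dirac _ config set0 R)) => F C hC.
by rewrite /= /mnormalize nuT onee_eq0 /= invr1 mule1 (nuE _ _ hC).
Qed.

End extension.

Definition local_events : set (set config) := [set C | exists F, depends_on F C].

Lemma measurable_configE : @measurable _ config = <<s local_events >>.
Proof.
apply/seteqP; split => C.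
  by apply: sub_sigma_algebra2 => _ [v _ <-]; exists [fset v]%fset; exact: depends_on1.
apply: smallest_sub; first exact: sigma_algebra_measurable.
by move=> D [F /depends_on_measurable].
Qed.

Lemma setI_closed_local : setI_closed local_events.
Proof. by move=> A B [F hA] [F' hB]; exists (F `|` F')%fset; exact: depends_onI. Qed.

Lemma measure_eq_local (R : realType) (m1 m2 : {measure set config -> \bar R}) :
  (m1 setT < +oo)%E -> (forall F C, depends_on F C -> m1 C = m2 C) ->
  forall C, measurable C -> m1 C = m2 C.
Proof.
move=> fin h; apply: (measure_unique local_events (fun=> setT)) => //.
- exact: measurable_configE.
- exact: setI_closed_local.
- by move=> _; exists fset0; exact: depends_onT.
- by rewrite bigcup_const.
- by move=> A [F]; exact: h.
Qed.

(** * Hard-core measures with boundary condition as free finite models *)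

Section hard_core_link.
Context {R : realType}.
Variable lam : Z2 -> R.
Implicit Types (L F S J K : {fset Z2}) (tau I : config) (C : set config).

Definition event_indic C J : R := \1_C ([set` J] : config).

Definition outer L tau : {fset Z2} :=
  [fset v in L | ~~ `[< exists u, [/\ tau u, u \notin L & adj v u] >]]%fset.

Lemma outer_sub L tau : (outer L tau `<=` L)%fset.
Proof. by apply/fsubsetP => v; rewrite inE => /andP[]. Qed.

Let glue L tau J : config := [set` J] `|` (tau `\` [set` L]).

Lemma glue_cap L tau J : (J `<=` L)%fset -> glue L tau J `&` [set` L] = [set` J].
Proof.
move=> /fsubsetP JL; apply/seteqP; split => [v [[//|[_ vL]]] //|v vJ].
by split; [left|exact: JL].
Qed.

Lemma glue_diff L tau J : (J `<=` L)%fset -> glue L tau J `\` [set` L] = tau `\` [set` L].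
Proof.
move=> /fsubsetP JL; apply/seteqP; split => [v [[/JL vL|//]] //|v [tv vL]].
by split => //; right.
Qed.

Lemma glue_bij L tau : independent_set (tau `\` [set` L]) ->
  set_bij [set` indsets (outer L tau)] (compatible [set` L] tau) (glue L tau).
Proof.
move=> itau; split.
- move=> J /=; rewrite in_indsets => /andP[/fsubsetP JS /indepP Ji].
  have JL : (J `<=` L)%fset by apply: fsubset_trans (outer_sub L tau); apply/fsubsetP.
  have nadj u v : u \in J -> (tau `\` [set` L]) v -> ~~ adj u v.
    move=> /JS; rewrite inE => /andP[_ /asboolPn h] [tv /negP vL].
    by apply/negP => uv; apply: h; exists v.
  split; last exact: glue_diff.
  move=> u v [uJ|ut] [vJ|vt] /adjP uv.
  + by have := Ji u v uJ vJ; rewrite uv.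
  + by have := nadj u v uJ vt; rewrite uv.
  + by have := nadj v u vJ ut; rewrite adjC uv.
  + by apply: (itau u v) => //; apply/adjP.
- have cap J : J \in [set` indsets (outer L tau)] -> glue L tau J `&` [set` L] = [set` J].
    rewrite inE /= in_indsets => /andP[JS _].
    by apply: glue_cap; apply: fsubset_trans JS (outer_sub _ _).
  move=> J J' /cap e /cap e' eg; apply/fsetP => v.
  have : [set` J] = [set` J'] by rewrite -e -e' eg.
  by move=> /seteqP[h h']; apply/idP/idP; [exact: h|exact: h'].
- move=> I [iI eI]; exists [fset v in L | `[< I v >]]%fset => /=.
    rewrite in_indsets; apply/andP; split.
      apply/fsubsetP => v; rewrite !inE => /andP[-> /asboolP Iv] /=.
      apply/asboolPn => -[u [tu uL vu]]; apply: (iI v u) => //; last exact/adjP.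
      have : (I `\` [set` L]) u by rewrite eI; split => //; exact/negP.
      by case.
    apply/indepP => u v; rewrite !inE => /andP[_ /asboolP Iu] /andP[_ /asboolP Iv].
    by apply/negP => /adjP; exact: iI.
  rewrite /glue -eI; apply/seteqP; split => v.
    by move=> [/=|[]//]; rewrite !inE => /andP[_ /asboolP].
  move=> Iv; have [vL|vL] := boolP (v \in L); [left|right].
    by rewrite /= !inE vL; exact/asboolP.
  by split => //; exact/negP.
Qed.

Lemma sum_compatible L tau C : independent_set (tau `\` [set` L]) ->
  \sum_(I \in compatible [set` L] tau `&` C) weight lam [set` L] I =
  wsum lam (outer L tau) (fun J => \1_C (glue L tau J)).
Proof.
move=> itau; rewrite fsbig_mkcondr (reindex_fsbig _ _ _ _ (glue_bij itau)).
rewrite -fsbig_seq ?fset_uniq // /wsum !big_seq; apply: eq_bigr => J.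
rewrite in_indsets => /andP[JS _]; have JL := fsubset_trans JS (outer_sub L tau).
rewrite /weight glue_cap // -fsbig_seq ?fset_uniq // indicE.
by case: ifP; rewrite ?mulr1 ?mulr0.
Qed.

Lemma partition_functionE L tau : independent_set (tau `\` [set` L]) ->
  partition_function lam [set` L] tau = pf lam (outer L tau).
Proof.
move=> itau; rewrite /partition_function -[compatible _ _]setIT sum_compatible //.
by apply: eq_wsum => J _; rewrite indicT.
Qed.

Lemma hard_core_restrict L tau C : independent_set (tau `\` [set` L]) ->
  pushforward (hard_core lam [set` L] tau) (restrict_config [set` L]) C =
  (expect lam (outer L tau) (event_indic C))%:E.
Proof.
move=> itau; rewrite /pushforward /hard_core sum_compatible // partition_functionE //.
congr (_ / _)%:E; apply: eq_wsum => J; rewrite in_indsets => /andP[JS _].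
have JL := fsubset_trans JS (outer_sub L tau).
rewrite /event_indic !indicE; congr (_%:R); congr nat_of_bool; apply/idP/idP.
  by rewrite !in_setE /= /restrict_config glue_cap.
by rewrite !in_setE /= /restrict_config glue_cap.
Qed.

(** No configuration is then compatible, so the numerator is an empty sum and the quotient is 0. For
    such [tau] the kernel is not a probability, but a Gibbs measure gives them no mass. *)
Lemma hard_core_dependent L tau C : ~ independent_set (tau `\` [set` L]) ->
  pushforward (hard_core lam [set` L] tau) (restrict_config [set` L]) C = 0%E.
Proof.
move=> itau; rewrite /pushforward /hard_core.
have -> : compatible [set` L] tau = set0.
  apply/seteqP; split => // I [iI eI]; apply: itau; rewrite -eI.
  by move=> u v [Iu _] [Iv _]; exact: iI.
by rewrite set0I fsbig_set0 mul0r.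
Qed.

End hard_core_link.

Definition pattern (F K : {fset Z2}) : set config :=
  [set I | forall v, v \in F -> I v <-> v \in K].

Lemma depends_on_pattern F K : depends_on F (pattern F K).
Proof. by move=> I I' II' h v vF; rewrite -II' // h. Qed.

Lemma pattern_sum (R : realType) (F : {fset Z2}) (psi : config -> R) (I : config) :
  (forall I I' : config, (forall v, v \in F -> I v <-> I' v) -> psi I = psi I') ->
  psi I = \sum_(K <- fpowerset F) psi [set` K] * \1_(pattern F K) I.
Proof.
move=> dep; pose K0 := [fset u in F | `[< I u >]]%fset.
have IK0 : forall v, v \in F -> I v <-> v \in K0 by move=> v; exact: trace_pattern.
have K0F : K0 \in fpowerset F.
  by rewrite fpowersetE; apply/fsubsetP => u; rewrite inE => /andP[].
rewrite (big_fsetD1 _ K0F) /= indicE mem_set // mulr1 big_seq big1 ?addr0.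
  by apply: dep => v vF; exact: IK0.
move=> K; rewrite !inE fpowersetE => /andP[/negP KK0 /fsubsetP KF].
rewrite indicE memNset ?mulr0 // => IK; apply: KK0; apply/eqP/fsetP => v.
apply/idP/idP => [vK|vK0].
  by apply/(IK0 _ (KF _ vK))/(IK _ (KF _ vK)).
have vF : v \in F by move: vK0; rewrite inE => /andP[].
by apply/(IK _ vF)/(IK0 _ vF).
Qed.

Lemma measurable_restrict M : measurable_fun setT (restrict_config M).
Proof.
apply: (@measurability _ _ config config setT (restrict_config M) cylinders) => //.
move=> _ [_ [v _ <-] <-]; rewrite setTI.
have [Mv|nMv] := pselect (M v).
  rewrite [X in measurable X](_ : _ = [set I | I v]); first exact: measurable_site.
  by apply/seteqP; split => [I []|I Iv].
by rewrite [X in measurable X](_ : _ = set0) //; apply/seteqP; split => // I [].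
Qed.

Lemma measurable_restrict_pre M C : measurable C -> measurable (restrict_config M @^-1` C).
Proof. by move=> mC; rewrite -[X in measurable X]setTI; exact: measurable_restrict. Qed.

Local Definition dependent i j : set config :=
  if adj (site i) (site j) then [set I | I (site i)] `&` [set I | I (site j)] else set0.

Lemma dependentE : ~` [set I : config | independent_set I] =
  \bigcup_i \bigcup_j dependent i j.
Proof.
apply/seteqP; split => [J nJ|J [i _ [j _]]].
  apply: contrapT => h; apply: nJ => u v Ju Jv /adjP uv; apply: h.
  exists (rank u); [exact: I|exists (rank v); [exact: I|]].
  by rewrite /dependent !rankK uv.
by rewrite /dependent; case: ifP => // /adjP ij [Ji Jj] /(_ _ _ Ji Jj).
Qed.

Lemma measurable_independent : measurable [set I : config | independent_set I].
Proof.
rewrite -[X in measurable X]setCK; apply: measurableC; rewrite dependentE.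
do 2![apply: bigcupT_measurable => ?]; rewrite /dependent; case: ifP => // _.
by apply: measurableI; exact: measurable_site.
Qed.

Lemma independent_null (R : realType) (mu : probability config R) :
  (forall u v, adj u v -> mu ([set I | I u] `&` [set I | I v]) = 0%E) ->
  mu (~` [set I : config | independent_set I]) = 0%E.
Proof.
move=> h; apply: measure_negligible.
  by apply: measurableC; exact: measurable_independent.
rewrite dependentE; do 2![apply: negligible_bigcup => ?].
rewrite /dependent; case: ifP => [/h h0|_]; last exact: negligible_set0.
by apply/negligibleP => //; apply: measurableI; exact: measurable_site.
Qed.

Definition neighbourhood (L : {fset Z2}) : {fset Z2} := [fset u in flatten (map neighbours L)]%fset.

Lemma mem_neighbourhood L v u : v \in L -> adj v u -> u \in neighbourhood L.
Proof.
move=> vL vu; rewrite inE; apply/flattenP; exists (neighbours v).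
  by apply/mapP; exists v.
by rewrite mem_neighbours.
Qed.

Lemma outer_eq L (I I' : config) :
  (forall v, v \in neighbourhood L -> v \notin L -> I v <-> I' v) ->
  outer L I = outer L I'.
Proof.
move=> II'; apply/fsetP => v; rewrite !inE; case: (boolP (v \in L)) => //= vL.
congr (~~ _); apply/asboolP/asboolP => -[u [Iu uL vu]]; exists u; split => //.
  by apply/II' => //; exact: mem_neighbourhood vu.
by apply/II' => //; exact: mem_neighbourhood vu.
Qed.

(** * Infinite-volume limits and the DLR equations *)

Section uniqueness.
Context {R : realType}.
Variable lam : Z2 -> R.
Hypothesis lam_ge0 : forall v, 0 <= lam v.
Hypothesis gap0 : forall v (e : R), 0 < e -> exists k, lam v * gap_box lam v k < e.
Implicit Types (L F S J K : {fset Z2}) (C : set config).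

Let B n := box (0, 0) n.

(** The boundary condition [true] is an arbitrary reference: by [event_limit_aux] every other choice
    gives the same limit. *)
Let p n C : R := expect lam (bd_sites (B n) true) (event_indic C).

Lemma gap_vanishes (s : seq Z2) (e : R) : 0 < e -> exists N, forall n, (N <= n)%N ->
  {in s, forall v, v \in core (B n)} /\ \sum_(v <- s) lam v * gap lam (B n) v < e.
Proof.
elim: s e => [|v s IH] e e0; first by exists 0%N => n _; split=> //; rewrite big_nil.
have e20 : 0 < e / 2 by rewrite divr_gt0.
have [N hN] := IH _ e20; have [k hk] := gap0 v e20.
exists (maxn N (k.+1 + absz v.1 + absz v.2))%N => n; rewrite geq_max => /andP[Nn kn].
have [h1 h2] := hN n Nn.
have sub : (box v k.+1 `<=` B n)%fset by apply: box_sub => /=; lia.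
split; last first.
  rewrite big_cons; apply: (@lt_le_trans _ _ (e / 2 + e / 2)); last by rewrite -splitr.
  apply: ltrD => //; apply: le_lt_trans hk; rewrite ler_wpM2l //.
  by apply: gap_antitone => // u; exact: adj_box.
move=> u; rewrite inE => /orP[/eqP ->|]; last exact: h1.
rewrite !inE; apply/andP; split.
  by apply: (fsubsetP sub); rewrite in_box !subrr normr0.
apply/allP => w; rewrite mem_neighbours => vw.
by apply: (fsubsetP sub); exact: adj_box.
Qed.

Lemma local_event_indic F C : depends_on F C -> local F (event_indic C : {fset Z2} -> R).
Proof.
move=> hC J; rewrite /event_indic !indicE; congr (_%:R); congr nat_of_bool.
by apply/idP/idP; rewrite !in_setE; apply: hC => v vF; rewrite /= !inE vF andbT.
Qed.

Lemma event_indic01 C J : 0 <= (event_indic C J : R) <= 1.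
Proof. by rewrite /event_indic indicE; case: (_ \in _); rewrite ?lexx ler01. Qed.

Lemma event_limit_aux F C (e : R) : depends_on F C -> 0 < e -> exists N, forall n, (N <= n)%N ->
  forall S, (core (B n) `<=` S)%fset -> `|expect lam S (event_indic C) - p n C| < e.
Proof.
move=> hC e0; have [N hN] := gap_vanishes F e0; exists N => n /hN[h1 h2] S BS.
apply: le_lt_trans h2; apply: local_estimate => //.
- by apply/fsubsetP => v; exact: h1.
- exact: local_event_indic.
- exact: event_indic01.
Qed.

Lemma core_B m n : (m <= n)%N -> (core (B m) `<=` core (B n))%fset.
Proof. by move=> mn; apply: core_sub; apply: box_sub; rewrite subrr normr0 add0r lez_nat. Qed.

Let l C : R := lim (p ^~ C @ \oo).

(** A Cauchy sequence: for n >= N the reference measure in [B n] is itself a free measure on a set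
    containing the core of [B N]. *)
Lemma p_cvg F C : depends_on F C -> p ^~ C @ \oo --> l C.
Proof.
move=> hC; apply/(@cauchy_cvgP R^o); apply: cauchy_exP => e e0.
have [N hN] := event_limit_aux hC e0; exists (p N C); exists N => // n /= Nn.
rewrite /ball /= distrC; apply: hN => //.
by apply: fsubset_trans (core_B Nn) (core_bd _ _).
Qed.

Lemma event_limit F C (e : R) : depends_on F C -> 0 < e -> exists N, forall n, (N <= n)%N ->
  forall S, (core (B n) `<=` S)%fset -> `|expect lam S (event_indic C) - l C| < e.
Proof.
move=> hC e0; have e20 : 0 < e / 2 by rewrite divr_gt0.
have [N hN] := event_limit_aux hC e20.
have /cvgrPdist_lt /(_ _ e20)[M _ hM] := p_cvg hC.
exists (maxn N M) => n; rewrite geq_max => /andP[Nn Mn] S BS.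
have h1 := hN n Nn S BS; have h2 := hM n Mn.
rewrite (le_lt_trans (ler_distD (p n C) _ _)) // [ltRHS]splitr.
by rewrite ltrD // distrC.
Qed.

Lemma l_ge0 F C : depends_on F C -> 0 <= l C.
Proof.
move=> hC; apply: limr_ge; first by apply/cvg_ex; exists (l C); exact: p_cvg hC.
by apply: nearW => n; apply: expect_ge0 => // J _; case/andP: (event_indic01 C J).
Qed.

Lemma pD C C' n : C `&` C' = set0 -> p n (C `|` C') = p n C + p n C'.
Proof.
move=> CC'; rewrite /p -expectD //; apply: eq_expect => J _; rewrite /event_indic !indicE in_setU.
have : ~ (C [set` J] /\ C' [set` J]).
  by move=> h; have : (C `&` C') [set` J] by []; rewrite CC'.
case: (boolP (_ \in C)) => [/set_mem h1|_]; case: (boolP (_ \in C')) => [/set_mem h2|_] //=.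
- by move=> [].
- by rewrite addr0.
- by rewrite add0r.
- by rewrite addr0.
Qed.

Lemma lD F C C' : depends_on F C -> depends_on F C' -> C `&` C' = set0 ->
  l (C `|` C') = l C + l C'.
Proof.
move=> hC hC' CC'; apply: cvg_lim => //.
have -> : p ^~ (C `|` C') = p ^~ C + p ^~ C' by apply/funext => n; rewrite pD.
by apply: cvgD; [exact: p_cvg hC|exact: p_cvg hC'].
Qed.

Lemma lT : l setT = 1.
Proof.
apply: cvg_lim => //; apply: cvg_near_cst; apply: nearW => n.
rewrite /p -[RHS](expect_cst lam_ge0 (bd_sites (B n) true)); apply: eq_expect => J _.
by rewrite /event_indic indicT.
Qed.

Lemma l_dependent u v : adj u v -> l ([set I | I u] `&` [set I | I v]) = 0.
Proof.
move=> uv; apply: cvg_lim => //; apply: cvg_near_cst; apply: nearW => n.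
rewrite /p -[RHS](expect_cst lam_ge0 (bd_sites (B n) true)); apply: eq_expect => J.
rewrite in_indsets => /andP[_ /indepP Ji].
rewrite /event_indic indicE; case: (boolP (_ \in _)) => // /set_mem[/= uJ vJ].
by have := Ji u v uJ vJ; rewrite uv.
Qed.

(** A local version of the kernel. It sees only the neighbourhood of [L], whereas [hard_core] also
    vanishes when the boundary condition fails to be independent arbitrarily far away. *)
Let g L C (I : config) : R := expect lam (outer L I) (event_indic C).

Lemma g_ge0 L C I : 0 <= g L C I.
Proof. by apply: expect_ge0 => // J _; case/andP: (event_indic01 C J). Qed.

Lemma g_restrict L C I : g L C (restrict_config (~` [set` L]) I) = g L C I.
Proof.
congr (expect lam _ _); apply: outer_eq => v _ /negP vL; rewrite /restrict_config /setI /=.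
by split => [[]|].
Qed.

Lemma measurable_g L C : measurable_fun setT (g L C).
Proof.
move=> _ Y mY; rewrite setTI; apply: (@depends_on_measurable (neighbourhood L)) => I I' II' /=.
by rewrite /g (@outer_eq L I I') // => v /II'.
Qed.

Lemma hard_coreE L C (I : config) :
  pushforward (hard_core lam [set` L] I) (restrict_config [set` L]) C =
  (g L C I * \1_(restrict_config (~` [set` L]) @^-1` [set I | independent_set I]) I)%:E.
Proof.
rewrite indicE; have [h|h] := pselect (independent_set (I `\` [set` L])).
  by rewrite hard_core_restrict // mem_set ?mulr1.
by rewrite hard_core_dependent // memNset ?mulr0.
Qed.

Lemma measurable_hard_core L C : measurable_fun setT
  (fun I : config => pushforward (hard_core lam [set` L] I) (restrict_config [set` L]) C).
Proof.
apply: (eq_measurable_fun (fun I => (g L C I *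
  \1_(restrict_config (~` [set` L]) @^-1` [set I | independent_set I]) I)%:E)).
  by move=> I _; rewrite hard_coreE.
apply/measurable_EFinP; apply: measurable_funM; first exact: measurable_g.
apply: measurable_indic; apply: measurable_restrict_pre; exact: measurable_independent.
Qed.

Lemma hard_core_ge0 L C (I : config) :
  (0 <= pushforward (hard_core lam [set` L] I) (restrict_config [set` L]) C)%E.
Proof. by rewrite hard_coreE lee_fin mulr_ge0 ?g_ge0. Qed.

Lemma depends_on_restrict L (A : set config) :
  depends_on L (restrict_config [set` L] @^-1` A : set config).
Proof.
move=> I I' II' /=; congr (A _); apply/seteqP; split => v [Iv vL]; split => //;
  exact/(II' v vL).
Qed.

Lemma depends_on_restrictC F L (A : set config) : depends_on F A ->
  depends_on F (restrict_config (~` [set` L]) @^-1` A).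
Proof.
move=> hA I I' II' /=; apply: hA => v vF; rewrite /restrict_config /setI /=.
by split=> -[/(II' v vF)].
Qed.

(** Finite-volume DLR equation, from the Markov property: once the part [K] outside [L] is fixed,
    the indicator of [C] is constant and [g] is the inner expectation. *)
Lemma expect_DLR L S (A C : set config) : (L `<=` S)%fset ->
  expect lam S (event_indic
    (restrict_config [set` L] @^-1` A `&` restrict_config (~` [set` L]) @^-1` C)) =
  expect lam S (fun J =>
    g L A [set` J] * \1_(restrict_config (~` [set` L]) @^-1` C) ([set` J] : config)).
Proof.
move=> LS; rewrite /expect !(@wsum_markov _ lam S L); congr (_ / _); apply: eq_wsum => K.
have -> : (S `&` L = L)%fset by apply/fsetIidPr.
rewrite in_indsets fsubsetD => /andP[/andP[_ /fdisjointP KL] _].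
have eK J : (J `<=` L)%fset ->
    restrict_config (~` [set` L]) [set` (K `|` J)%fset] = [set` K].
  move=> /fsubsetP JL; apply/seteqP; split => v.
    by move=> [/=]; rewrite inE => /orP[//|/JL vL]; move=> /(_ vL).
  by move=> vK; split; [rewrite /= inE vK|exact/negP/KL].
have eJ J : (J `<=` L)%fset ->
    restrict_config [set` L] [set` (K `|` J)%fset] = [set` J].
  move=> /fsubsetP JL; apply/seteqP; split => v.
    by move=> [/=]; rewrite inE => /orP[/KL/negP //|].
  by move=> vJ; split; [rewrite /= inE vJ orbT|exact: JL].
have eg J : (J `<=` L)%fset -> g L A [set` (K `|` J)%fset] = expect lam (excl L K) (event_indic A).
  move=> JL; rewrite -g_restrict eK //; congr (expect lam _ _).
  apply/fsetP => v; rewrite in_excl !inE; congr (_ && ~~ _).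
  apply/asboolP/hasP => [[u [uK _ vu]]|[u uK vu]]; first by exists u.
  by exists u; split => //; exact: KL.
have sub J : J \in indsets (excl L K) -> (J `<=` L)%fset.
  rewrite in_indsets => /andP[/fsubsetP h _]; apply/fsubsetP => v /h.
  by rewrite in_excl => /andP[].
transitivity (wsum lam (excl L K) (fun J => \1_C ([set` K] : config) * event_indic A J)).
  apply: eq_wsum => J /sub JL; rewrite /event_indic indicI /= !indicE.
  rewrite mulrC; congr (_%:R * _%:R); congr nat_of_bool.
    by apply/idP/idP; rewrite !in_setE /= eK.
  by apply/idP/idP; rewrite !in_setE /= eJ.
rewrite [RHS](@eq_wsum _ _ (excl L K) _
  (fun J => \1_C ([set` K] : config) * expect lam (excl L K) (event_indic A) * 1)); last first.
  move=> J /sub JL.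
  rewrite eg // mulr1 mulrC; congr (_ * _).
  rewrite !indicE; congr (_%:R); congr nat_of_bool.
  by apply/idP/idP; rewrite !in_setE /= eK.
by rewrite !wsumZ [wsum lam _ (event_indic A)]wsumE // mulrA.
Qed.

Section gibbs_measure.
Variable mu : probability config R.
Hypothesis muE : forall F C, depends_on F C -> mu C = (l C)%:E.

Let mu_null : mu (~` [set I : config | independent_set I]) = 0%E.
Proof.
apply: independent_null => u v uv.
by rewrite (muE (depends_onI (@depends_on1 u) (@depends_on1 v))) l_dependent.
Qed.

Lemma mu_independent : mu [set I | independent_set I] = 1%E.
Proof.
rewrite -[X in mu X]setCK probability_setC ?mu_null ?sube0 //.
by apply: measurableC; exact: measurable_independent.
Qed.

(** After restriction to the complement of [L], the kernel and [g] can differ only at configurations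
    that are not independent, and these are null. *)
Lemma integral_hard_core L (A C : set config) : measurable C ->
  (\int[mu]_(I in restrict_config (~` [set` L]) @^-1` C)
    pushforward (hard_core lam [set` L] (restrict_config (~` [set` L]) I))
      (restrict_config [set` L]) A =
  \int[mu]_I (g L A I * \1_(restrict_config (~` [set` L]) @^-1` C) I)%:E)%E.
Proof.
move=> mC; set D := restrict_config _ @^-1` C.
have mD : measurable D by exact: measurable_restrict_pre.
have mN : measurable (~` [set I : config | independent_set I]).
  by apply: measurableC; exact: measurable_independent.
rewrite (@ge0_negligible_integral _ _ _ _ _ _ _ mN mD _ _ mu_null); first last.
- by move=> I _; exact: hard_core_ge0.
- apply: measurable_funTS; apply: (measurableT_comp (measurable_hard_core L A)).
  exact: measurable_restrict.
transitivity (\int[mu]_(I in D) (g L A I)%:E)%E; last first.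
  rewrite integral_mkcond; apply: eq_integral => I _.
  by rewrite patchE indicE; case: (I \in D); rewrite ?mulr1 ?mulr0.
rewrite [RHS](@ge0_negligible_integral _ _ _ _ _ _ _ mN mD _ _ mu_null); first last.
- by move=> I _; rewrite lee_fin g_ge0.
- by apply: measurable_funTS; apply/measurable_EFinP; exact: measurable_g.
apply: eq_integral => I; rewrite inE => -[_ /contrapT iI].
rewrite hard_coreE g_restrict indicE mem_set ?mulr1 //=.
move=> u v; rewrite /restrict_config /setI /= => -[[Iu _] _] [[Iv _] _].
exact: iI.
Qed.

(** The integrand depends on finitely many sites, so it is a finite combination of indicators of
    patterns, and the identity is the limit of [expect_DLR] along the boxes. *)
Lemma local_DLR L F (A C : set config) : depends_on F C ->
  mu (restrict_config [set` L] @^-1` A `&` restrict_config (~` [set` L]) @^-1` C) =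
  (\int[mu]_(I in restrict_config (~` [set` L]) @^-1` C)
    pushforward (hard_core lam [set` L] (restrict_config (~` [set` L]) I))
      (restrict_config [set` L]) A)%E.
Proof.
move=> hC; rewrite integral_hard_core; last exact: depends_on_measurable hC.
set CA := restrict_config [set` L] @^-1` A; set D := restrict_config _ @^-1` C.
have hD : depends_on F D by exact: depends_on_restrictC.
pose psi I := g L A I * \1_D I; pose F' := (neighbourhood L `|` F)%fset.
have dep (I I' : config) : (forall v, v \in F' -> I v <-> I' v) -> psi I = psi I'.
  move=> II'; rewrite /psi /g (@outer_eq L I I'); last first.
    by move=> v vL _; apply: II'; rewrite inE vL.
  congr (_ * _); rewrite !indicE; congr (_%:R); congr nat_of_bool.
  apply/idP/idP; rewrite !in_setE; apply: hD => v vF; [|apply: iff_sym];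
    by apply: II'; rewrite inE vF orbT.
have psi_ge0 I : 0 <= psi I by rewrite mulr_ge0 ?g_ge0.
have -> : (\int[mu]_I (g L A I * \1_D I)%:E =
    \sum_(K <- fpowerset F') (psi [set` K] * l (pattern F' K))%:E)%E.
  under eq_integral => I _.
    rewrite -[_ * _]/(psi I) (pattern_sum _ dep) -sumEFin; over.
  rewrite ge0_integral_sum //.
  - apply: eq_bigr => K _; under eq_integral do rewrite EFinM.
    rewrite ge0_integralZl_EFin //.
    + rewrite integral_indic ?setIT //; last exact: measurable_pattern.
      rewrite [RHS]EFinM; congr (_ * _)%E; exact: muE (@depends_on_pattern F' K).
    + apply/measurable_EFinP; apply: measurable_indic; exact: measurable_pattern.
  - move=> K; apply/measurable_EFinP; apply: measurable_funM => //.
    apply: measurable_indic; exact: measurable_pattern.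
  - by move=> K I _; rewrite lee_fin mulr_ge0.
have hCA := depends_onI (@depends_on_restrict L A) hD.
rewrite (muE hCA) sumEFin; congr EFin.
apply: cvg_lim => //.
have : (fun n => \sum_(K <- fpowerset F') psi [set` K] * p n (pattern F' K)) @ \oo -->
    \sum_(K <- fpowerset F') psi [set` K] * l (pattern F' K).
  apply: cvg_big => [|K _]; first exact: add_continuous.
  by apply: cvgMl_tmp; exact: p_cvg (@depends_on_pattern _ _).
apply: cvg_trans; apply: near_eq_cvg.
have [N hN] := gap_vanishes L ltr01.
exists N => // n /= /hN[LB _].
have LS : (L `<=` bd_sites (B n) true)%fset.
  by apply/fsubsetP => v /LB; exact: (fsubsetP (core_bd _ _)).
rewrite /p (expect_DLR _ _ LS) (@eq_expect _ lam _ _ (fun J : {fset Z2} =>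
  \sum_(K <- fpowerset F') psi [set` K] * event_indic (pattern F' K) J)).
  by rewrite expect_sum //; apply: eq_bigr => K _; rewrite expectZ.
by move=> J _; rewrite -(pattern_sum _ dep).
Qed.

(** Any measurable [A] becomes a local event once restricted to the finite set [L]. The outer event
    is local in [local_DLR]; the events satisfying the identity form a Dynkin system, hence include
    all measurable ones. *)
Lemma gibbs_limit : gibbs lam mu.
Proof.
split; first exact: mu_independent.
move=> _ /finite_fsetP[L ->] A mA; split; first exact: measurable_hard_core.
move=> C; rewrite measurable_configE -(setI_closed_g_dynkin_g_sigma_algebra setI_closed_local).
set T1 := restrict_config [set` L]; set T2 := restrict_config (~` [set` L]).
set k := fun I : config => pushforward (hard_core lam [set` L] (T2 I)) T1 A.
have k_ge0 I : (0 <= k I)%E by exact: hard_core_ge0.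
have mk : measurable_fun setT k.
  by apply: (measurableT_comp (measurable_hard_core L A)); exact: measurable_restrict.
have mT2 D : measurable D -> measurable (T2 @^-1` D) by exact: measurable_restrict_pre.
have mT1 : measurable (T1 @^-1` A) by exact: measurable_restrict_pre.
pose Q := [set D : set config | measurable D /\
  mu (T1 @^-1` A `&` T2 @^-1` D) = (\int[mu]_(I in T2 @^-1` D) k I)%E].
suff h : (<<d local_events>> `<=` Q) by move=> /h[].
apply: smallest_sub; last first.
  by move=> D [F hD]; split; [exact: depends_on_measurable hD|exact: local_DLR hD].
have QT : Q setT by split => //; exact: local_DLR depends_onT.
split => //.
- move=> D [mD eD]; split; first exact: measurableC.
  have mU : mu (T1 @^-1` A `&` T2 @^-1` setT) =
      (mu (T1 @^-1` A `&` T2 @^-1` D) + mu (T1 @^-1` A `&` T2 @^-1` (~` D)))%E.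
    rewrite -measureU; [|exact: measurableI (mT2 _ _)|
        exact: measurableI (mT2 _ (measurableC _))|].
      by rewrite -setIUr -preimage_setU setUCr.
    by rewrite setIACA preimage_setC setICr setI0.
  have iU : (\int[mu]_(I in T2 @^-1` setT) k I = \int[mu]_(I in T2 @^-1` D) k I +
      \int[mu]_(I in T2 @^-1` (~` D)) k I)%E.
    rewrite -ge0_integral_setU //.
    + by rewrite -preimage_setU setUCr.
    + exact: mT2.
    + exact: mT2 (measurableC mD).
    + exact: measurable_funTS.
    + by apply/disj_setPS; rewrite preimage_setC setICr.
  have fin : (\int[mu]_(I in T2 @^-1` D) k I)%E \is a fin_num.
    by rewrite -eD fin_num_measure //; exact: measurableI (mT2 _ _).
  move: mU; rewrite QT.2 iU eD => /(congr1 (fun x => x - \int[mu]_(I in T2 @^-1` D) k I)%E).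
  by rewrite ![(\int[mu]_(I in T2 @^-1` D) k I + _)%E]addeC !addeK.
- move=> D tD QD; have mD n : measurable (D n) by case: (QD n).
  split; first exact: bigcupT_measurable.
  have tT2 : trivIset setT (fun n => T2 @^-1` D n).
    by apply/trivIsetP => i j _ _ ij; rewrite -preimage_setI (trivIsetP.1 tD).
  have mTD n : measurable (T1 @^-1` A `&` T2 @^-1` D n).
    exact: measurableI (mT2 _ _).
  rewrite preimage_bigcup setI_bigcupr measure_semi_bigcup //; first last.
  + exact: bigcupT_measurable.
  + exact: trivIset_setIl.
  rewrite ge0_integral_bigcup //.
  + by apply: eq_eseriesr => n _; case: (QD n).
  + by move=> n; exact: mT2.
  + exact: measurable_funTS.
Qed.

End gibbs_measure.

(** By the DLR equation in a large box, [nu C] is an average of finite-volume probabilities under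
    random boundary conditions. Each is within [e] of [l C], because [outer L I] always contains the
    core of [L]. *)
Lemma gibbs_local (nu : probability config R) F C : gibbs lam nu ->
  depends_on F C -> nu C = (l C)%:E.
Proof.
move=> [nu1 nuG] hC.
have mN : measurable (~` [set I : config | independent_set I]).
  by apply: measurableC; exact: measurable_independent.
have mI := measurable_independent.
have nuN : nu (~` [set I : config | independent_set I]) = 0%E.
  by rewrite probability_setC // nu1 subee.
have mC := depends_on_measurable hC.
have bounds e : 0 < e -> ((l C - e)%:E <= nu C <= (l C + e)%:E)%E.
  move=> e0; have [N hN] := event_limit hC e0; have [M hM] := gap_vanishes F e0.
  pose n := maxn N M; pose L := B n.
  have FL : (F `<=` core L)%fset.
    by apply/fsubsetP => v; apply: (hM n (leq_maxr _ _)).1.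
  have gl I : `|g L C I - l C| < e.
    apply: (hN n (leq_maxl _ _)); apply/fsubsetP => v.
    rewrite !inE => /andP[vL /allP nv]; rewrite vL /=.
    apply/asboolPn => -[u [_ /negP uL vu]]; apply: uL; apply: nv.
    by rewrite mem_neighbours.
  have [mk /(_ setT measurableT)] := nuG [set` L] (finite_fset L) C mC.
  rewrite preimage_setT setIT.
  have -> : restrict_config [set` L] @^-1` C = C.
    apply/seteqP; split => I /=; apply: hC => v vF; rewrite /restrict_config /setI /=;
      have vL : v \in L by apply: (fsubsetP (core_sub_self L)); exact: (fsubsetP FL).
      by split => // -[].
    by split => // -[].
  set k := (fun I : config => _); move=> ->.
  have k_ge0 I : (0 <= k I)%E by exact: hard_core_ge0.
  have mk' : measurable_fun setT k.
    by apply: (measurableT_comp (measurable_hard_core L C)); exact: measurable_restrict.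
  rewrite (@ge0_negligible_integral _ _ _ _ _ _ _ mN measurableT _ _ nuN) //; last first.
    by move=> I _; exact: k_ge0.
  rewrite setTD setCK.
  have kE I : independent_set I -> k I = (g L C I)%:E.
    move=> iI; rewrite /k hard_coreE g_restrict indicE mem_set ?mulr1 //=.
    move=> u v; rewrite /restrict_config /setI /= => -[[Iu _] _] [[Iv _] _].
    exact: iI.
  have cstE (r : R) : (\int[nu]_(I in [set I : config | independent_set I]) cst r%:E I = r%:E)%E.
    by rewrite integral_cst // -[RHS]mule1; congr (_ * _)%E.
  apply/andP; split.
    (* The comparison of integrals is for nonnegative functions, hence the truncation at 0. *)
    apply: (@le_trans _ _ (Num.max 0 (l C - e))%:E); first by rewrite lee_fin le_max lexx orbT.
    rewrite -[leLHS]cstE; apply: ge0_le_integral => //.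
    - by move=> I _; rewrite lee_fin le_max lexx.
    - exact: measurable_funTS.
    - move=> I /kE; rewrite /k => ->; rewrite lee_fin ge_max g_ge0 /=.
      by have := gl I; rewrite ltr_norml => /andP[h _]; lra.
  rewrite -[leRHS]cstE; apply: ge0_le_integral => //.
  - by move=> I _; exact: k_ge0.
  - exact: measurable_funTS.
  - move=> I /kE; rewrite /k => ->; rewrite lee_fin.
    by have := gl I; rewrite ltr_norml => /andP[_ h]; lra.
have fin : nu C \is a fin_num by exact: fin_num_measure.
rewrite -(fineK fin); congr EFin; apply/eqP; rewrite eq_le; apply/andP; split.
  by apply/ler_addgt0Pl => e /bounds /andP[_]; rewrite -(fineK fin) lee_fin addrC.
apply/ler_addgt0Pl => e /bounds /andP[+ _]; rewrite -(fineK fin) lee_fin.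
by rewrite lerBlDl.
Qed.

Theorem uniqueness : gibbs_singleton lam.
Proof.
have [mu muE] := extension l_ge0 lT lD.
exists mu; split; first exact: gibbs_limit.
move=> nu nuG A mA; apply: measure_eq_local => //.
  by apply: (@le_lt_trans _ _ 1%E); [exact: probability_le1|exact: ltry].
by move=> F C hC; exact: etrans (gibbs_local nuG hC) (esym (muE _ _ hC)).
Qed.

End uniqueness.

(** * Vanishing of the gaps in a random environment *)

Definition coordinate_sets (R : realType) : set (set (Z2 -> R)) :=
  [set A | exists v B, measurable B /\ A = [set x | B (x v)]].

Definition env (R : realType) := g_sigma_algebraType (@coordinate_sets R).
HB.instance Definition _ (R : realType) := Measurable.on (env R).

Section environments.
Context {R : realType}.

Definition rectangles : set (set (env R)) :=
  [set A | exists (F : {fset Z2}) B, (forall v, measurable (B v)) /\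
    A = \bigcap_(v in [set` F]) [set x : env R | B v (x v)]].

Lemma measurable_coordinate v : measurable_fun setT (fun x : env R => x v).
Proof.
move=> _ B mB; rewrite setTI; apply: sub_sigma_algebra; by exists v, B.
Qed.

Lemma measurable_envE : @measurable _ (env R) = <<s rectangles >>.
Proof.
apply/seteqP; split => C.
  apply: sub_sigma_algebra2 => _ [v [B [mB ->]]].
  exists [fset v]%fset, (fun=> B); split => //.
  apply/seteqP; split => [x Bx u /= /[!inE] /eqP -> //|x /(_ v)]; apply.
  by rewrite /= inE.
apply: smallest_sub; first exact: sigma_algebra_measurable.
move=> _ [F [B [mB ->]]]; apply: fin_bigcap_measurable; first exact: finite_fset.
move=> v _; have := @measurable_coordinate v measurableT _ (mB v).
by rewrite setTI.
Qed.

Lemma setI_closed_rectangles : setI_closed rectangles.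
Proof.
move=> _ _ [F [B [mB ->]]] [F' [B' [mB' ->]]].
exists (F `|` F')%fset, (fun v => (if v \in F then B v else setT) `&`
  (if v \in F' then B' v else setT)); split.
  by move=> v; apply: measurableI; case: ifP.
apply/seteqP; split => [x [h h'] v /= _|x h].
  by split; case: ifPn => // vF; [exact: h|exact: h'].
split => v /= vF.
  by have := h v; rewrite /= inE vF => /(_ isT)[].
by have := h v; rewrite /= inE vF orbT => /(_ isT)[].
Qed.

Lemma env_measure_unique (m1 m2 : {measure set (env R) -> \bar R}) :
  (m1 setT < +oo)%E -> {in rectangles, m1 =1 m2} ->
  forall A, measurable A -> m1 A = m2 A.
Proof.
move=> fin h; apply: (measure_unique rectangles (fun=> setT)) => //.
- exact: measurable_envE.
- exact: setI_closed_rectangles.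
- move=> _; exists fset0, (fun=> setT); split => //.
  by apply/seteqP; split.
- by rewrite bigcup_const.
- by move=> A rA; apply: h; exact: mem_set.
Qed.

Lemma measurable_env d (T : measurableType d) (f : T -> env R) :
  (forall v, measurable_fun setT (fun w => f w v)) -> measurable_fun setT f.
Proof.
move=> mf; apply: (@measurability _ _ T (env R) setT f (@coordinate_sets R)) => //.
move=> _ [_ [v [B [mB ->]]] <-]; have := mf v measurableT B mB.
by rewrite !setTI.
Qed.

End environments.

(** * Translation invariance and independence for an i.i.d. field *)

Section product_environment.
Context d (T : measurableType d) (R : realType) (P : probability T R).
Variable Y : Z2 -> T -> R.
Hypothesis mY : forall v, measurable_fun setT (Y v).
Hypothesis Y_ind : forall (F : {fset Z2}) (B : Z2 -> set R), (forall v, measurable (B v)) ->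
  P (\bigcap_(v in [set` F]) (Y v @^-1` B v)) = (\prod_(v <- F) P (Y v @^-1` B v))%E.
Hypothesis Y_id : forall u v (B : set R), measurable B -> P (Y u @^-1` B) = P (Y v @^-1` B).

Definition field (w : T) : env R := fun v => Y v w.

Lemma measurable_field : measurable_fun setT field.
Proof. exact: measurable_env. Qed.

Lemma measurable_Y_pre v (B : set R) : measurable B -> measurable (Y v @^-1` B).
Proof. by move=> mB; rewrite -[X in measurable X]setTI; exact: mY. Qed.

(** The field and its translate have the same law: both give a rectangle the product of the same
    one-site probabilities, and rectangles determine the law. *)
Lemma integral_shift t (F : env R -> R) : measurable_fun setT F -> (forall x, 0 <= F x) ->
  (\int[P]_w (F (field w))%:E = \int[P]_w (F (fun v => field w (translate t v)))%:E)%E.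
Proof.
move=> mF F0.
have mf2 : measurable_fun setT ((fun w v => field w (translate t v)) : T -> env R).
  by apply: measurable_env => v; exact: mY.
have mF' : measurable_fun setT (EFin \o F) by exact/measurable_EFinP.
rewrite -(ge0_integral_pushforward measurable_field P measurableT mF'); last first.
  by move=> x _; rewrite lee_fin.
rewrite -(ge0_integral_pushforward mf2 P measurableT mF'); last first.
  by move=> x _; rewrite lee_fin.
pose m1 := measure_function_pushforward__canonical__measure_function_Measure P measurable_field.
pose m2 := measure_function_pushforward__canonical__measure_function_Measure P mf2.
apply: (eq_measure_integral m2 (m1 := m1)) => A mA _; apply: env_measure_unique => //.
  by rewrite /m1 /= /pushforward preimage_setT probability_setT ltry.
move=> _ /set_mem[G [B [mB ->]]]; rewrite /m1 /m2 /= /pushforward.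
rewrite !preimage_bigcap (Y_ind G mB).
pose t' : Z2 := (- t.1, - t.2).
have trK' v : translate t' (translate t v) = v by case: v => v1 v2; rewrite /translate /= !addrK.
transitivity (P (\bigcap_(v in [set` shift t G]) (Y v @^-1` B (translate t' v)))).
  rewrite (Y_ind _ (fun v => mB (translate t' v))) big_imfset /=; last first.
    by move=> ? ? _ _; exact: translate_inj.
  by apply: eq_bigr => v _; rewrite trK'; exact: Y_id.
congr (P _); apply/seteqP; split => w hw v /= vG.
  have := hw (translate t v); rewrite /= mem_shift trK'; exact.
have := hw (translate t' v); rewrite /= translateK; apply.
by rewrite -(mem_shift t) translateK.
Qed.

(** Setting the coordinate [u] to 0 does not change [F]. The law of the modified field under [P]
    restricted to the event at [u] is the probability of that event times its law under [P]: this is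
    checked on rectangles. *)
Lemma integral_indep u (F : env R -> R) (B : set R) : measurable_fun setT F ->
  (forall x, 0 <= F x) -> (forall x y, F (update x u y) = F x) -> measurable B ->
  (\int[P]_w (F (field w) * \1_(Y u @^-1` B) w)%:E =
   P (Y u @^-1` B) * \int[P]_w (F (field w))%:E)%E.
Proof.
move=> mF F0 Fu mB; set expect := Y u @^-1` B.
have mE : measurable expect by exact: measurable_Y_pre.
pose f w : env R := update (field w) u 0.
have mf : measurable_fun setT f.
  apply: measurable_env => v; rewrite /f /update; case: eqP => _; last exact: mY.
  exact: measurable_cst.
have mF' : measurable_fun setT (EFin \o F) by exact/measurable_EFinP.
have mFf : measurable_fun setT (fun w => (F (f w))%:E).
  exact: (measurableT_comp mF' mf).
have p_ge0 : 0 <= fine (P expect) by rewrite fine_ge0.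
have pE : P expect = (fine (P expect))%:E by rewrite fineK // fin_num_measure.
pose m1 := measure_function_pushforward__canonical__measure_function_Measure
  (mrestr P mE) mf.
pose m2 : {measure set (env R) -> \bar R} := mscale (NngNum p_ge0)
  (measure_function_pushforward__canonical__measure_function_Measure P mf).
have m12 A : measurable A -> m1 A = m2 A.
  apply: env_measure_unique.
    rewrite /m1 /= /pushforward /mrestr preimage_setT setTI.
    by rewrite pE ltry.
  move=> _ /set_mem[G [C [mC ->]]]; rewrite /m1 /m2 /= /mscale /= /pushforward /mrestr.
  rewrite !preimage_bigcap -pE.
  have [[uG nC]|h] := pselect (u \in G /\ ~ C u 0).
    have -> : \bigcap_(v in [set` G]) (f @^-1` [set x | C v (x v)]) = set0.
      by apply/seteqP; split => // w /(_ u uG) /=; rewrite /f /update eqxx.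
    by rewrite set0I !measure0 mule0.
  pose G' := (G `\ u)%fset.
  have -> : \bigcap_(v in [set` G]) (f @^-1` [set x | C v (x v)]) =
      \bigcap_(v in [set` G']) (Y v @^-1` C v).
    apply/seteqP; split => w hw v /=.
      rewrite !inE => /andP[/negbTE vu vG]; have := hw v vG.
      by rewrite /= /f /update vu.
    move=> vG; rewrite /f /update; have [vu|vu] := eqVneq v u.
      by subst v; apply: contrapT => nC; apply: h.
    by have := hw v; rewrite /= !inE vu vG => /(_ isT).
  pose C' v := if v == u then B else C v.
  have mC' v : measurable (C' v) by rewrite /C'; case: ifP.
  have uG' : u \notin G' by rewrite !inE eqxx.
  have C'E v : v \in G' -> C' v = C v by move=> /fsetD1P[/negbTE vu _]; rewrite /C' vu.
  transitivity (P (\bigcap_(v in [set` (u |` G')%fset]) (Y v @^-1` C' v))).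
    congr (P _); apply/seteqP; split => w.
      move=> [hw wE] v /= /fset1UP[->|vG']; first by rewrite /C' eqxx.
      by rewrite C'E //; exact: hw.
    move=> hw; split; last by have := hw u; rewrite /C' eqxx /=; apply; rewrite fset1U1.
    by move=> v /= vG'; rewrite -C'E //; apply: hw; exact: fset1Ur.
  rewrite Y_ind // big_fsetU1 //= {1}/C' eqxx (Y_ind _ mC); congr (_ * _)%E.
  by rewrite !big_seq; apply: eq_bigr => v /C'E ->.
transitivity (\int[P]_(w in expect) (F (f w))%:E)%E.
  rewrite [RHS]integral_mkcond; apply: eq_integral => w _.
  rewrite patchE indicE /f Fu; case: ifP => _; last by rewrite mulr0.
  by rewrite mulr1.
transitivity (\int[mrestr P mE]_(w in expect) (F (f w))%:E)%E.
  by apply: eq_measure_integral => A mA AE; rewrite /= /mrestr setIidl.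
transitivity (\int[mrestr P mE]_w (F (f w))%:E)%E.
  rewrite [RHS](@ge0_negligible_integral _ _ _ _ _ (~` expect)) ?setTD ?setCK //.
  - exact: measurableC.
  - by move=> w _; rewrite lee_fin.
  - by rewrite /= /mrestr setICl measure0.
transitivity (\int[m1]_x (F x)%:E)%E.
  rewrite [RHS](ge0_integral_pushforward mf (mrestr P mE) measurableT mF') //.
  by move=> x _; rewrite lee_fin.
rewrite (eq_measure_integral m2); last by move=> A mA _; exact: m12.
rewrite /m2 ge0_integral_mscale //; last by move=> x _; rewrite lee_fin.
rewrite -pE; congr (_ * _)%E.
rewrite [LHS](ge0_integral_pushforward mf P measurableT mF') /=; last first.
  by move=> x _; rewrite lee_fin.
by apply: eq_integral => w _; rewrite /f Fu.
Qed.

End product_environment.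

Section measurability.
Context {R : realType}.
Implicit Types (S L : {fset Z2}) (phi : {fset Z2} -> R) (x : env R).

Lemma measurable_invr : measurable_fun setT (@GRing.inv R).
Proof.
(* Real powers are measurable, and this formula also agrees with the convention that the inverse of
   0 is 0. *)
rewrite (_ : GRing.inv = fun y : R => y * (y ^+ 2) `^ (-1)); last first.
  apply/funext => y; rewrite powR_inv1 ?sqr_ge0 //.
  by have [->|y0] := eqVneq y 0; [rewrite invr0 mul0r|rewrite expr2 invfM mulrA divff ?mul1r].
apply: measurable_funM => //.
have h : measurable_fun setT (fun y : R => y ^+ 2) by exact: measurable_funX.
have hp : measurable_fun setT (fun y : R => y `^ (-1)) by exact: measurable_powR.
exact: (measurableT_comp hp h).
Qed.

Lemma measurable_wsum S phi : measurable_fun setT (fun x => wsum x S phi).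
Proof.
apply: measurable_sum => J; apply: measurable_funM => //.
by apply: (@measurable_prod _ (env R) R setT Z2 J (fun v x => x v)) => v _;
  exact: measurable_coordinate.
Qed.

Lemma measurable_pf S : measurable_fun setT (fun x => pf x S : R).
Proof. exact: measurable_wsum. Qed.

Lemma measurable_ratio S v : measurable_fun setT (fun x => ratio x S v).
Proof.
apply: measurable_funM; first exact: measurable_pf.
exact: measurableT_comp measurable_invr (measurable_pf _).
Qed.

Lemma measurable_gap L v : measurable_fun setT (fun x => gap x L v).
Proof. by apply: measurable_funB; exact: measurable_ratio. Qed.

Lemma measurable_free_diff L b : measurable_fun setT (fun x => free_diff x L b).
Proof.
by apply: measurable_funB; apply: (measurableT_comp (@measurable_ln R)); exact: measurable_pf.
Qed.

End measurability.

Lemma eq_gap (R : realType) (lam lam' : Z2 -> R) (L : {fset Z2}) v :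
  {in L, lam =1 lam'} -> gap lam L v = gap lam' L v.
Proof.
move=> e; congr (_ - _); apply: eq_ratio => u /fsetD1P[_ uL];
  by apply: e; exact: (fsubsetP (bd_sub L _)) uL.
Qed.

(** Four sides of 2 * (k + 1) + 1 sites each, the corners being counted twice. *)
Lemma card_box_boundary c k : (#|` (box c k.+1 `\` core (box c k.+1))%fset| <= 4 * k.*2.+3)%N.
Proof.
rewrite core_box; pose it := iota 0 k.*2.+3.
pose s : seq Z2 := [seq (c.1 + k.+1%:Z, c.2 + i%:Z - k.+1%:Z) | i <- it] ++
  [seq (c.1 - k.+1%:Z, c.2 + i%:Z - k.+1%:Z) | i <- it] ++
  [seq (c.1 + i%:Z - k.+1%:Z, c.2 + k.+1%:Z) | i <- it] ++
  [seq (c.1 + i%:Z - k.+1%:Z, c.2 - k.+1%:Z) | i <- it].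
have -> : (4 * k.*2.+3 = size s)%N by rewrite !size_cat !size_map !size_iota; lia.
apply: uniq_leq_size => [|u]; first exact: fset_uniq.
rewrite in_fsetD !in_box !mem_cat => /andP[n /andP[h1 h2]].
have side (z w : int) : `|z - w| <= k.+1%:Z -> exists2 i, i \in it & z = w + i%:Z - k.+1%:Z.
  by move=> h; exists (absz (z - w + k.+1%:Z)); rewrite ?mem_iota; lia.
have [i1 m1 e1] := side _ _ h1; have [i2 m2 e2] := side _ _ h2.
have [f1|f1] := eqVneq u.1 (c.1 + k.+1%:Z).
  by apply/orP; left; apply/mapP; exists i2 => //; rewrite -f1 -e2; case: (u).
have [f2|f2] := eqVneq u.1 (c.1 - k.+1%:Z).
  apply/orP; right; apply/orP; left; apply/mapP; exists i2 => //.
  by rewrite -f2 -e2; case: (u).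
have [f3|f3] := eqVneq u.2 (c.2 + k.+1%:Z).
  apply/orP; right; apply/orP; right; apply/orP; left; apply/mapP; exists i1 => //.
  by rewrite -f3 -e1; case: (u).
have f4 : u.2 = c.2 - k.+1%:Z by move: f1 f2 f3 h1 h2 n; clear; lia.
do 3![apply/orP; right]; apply/mapP; exists i1 => //.
by rewrite -f4 -e1; case: (u).
Qed.

Lemma card_box c k : #|` box c k| = #|` box (0, 0) k|.
Proof.
have e : c = translate c (0, 0) by case: c => c1 c2; rewrite /translate /= !add0r.
by rewrite {1}e -shift_box card_imfset //; exact: translate_inj.
Qed.

(** Both coordinates are even: these sites all have parity [false] and still fill a fixed proportion
    of the box of radius about 2l. *)
Definition even_sites (l : nat) : seq Z2 :=
  [seq ((i.*2)%:Z, (j.*2)%:Z) | i <- iota 0 l, j <- iota 0 l].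

Lemma uniq_even_sites l : uniq (even_sites l).
Proof.
apply: allpairs_uniq; rewrite ?iota_uniq // => -[i j] [i' j'] _ _ /= [].
by move=> /eqP; rewrite -!muln2 ?eqn_pmul2r // => /eqP -> /eqP; rewrite eqn_pmul2r // => /eqP ->.
Qed.

Lemma size_even_sites l : size (even_sites l) = (l * l)%N.
Proof. by rewrite size_allpairs !size_iota. Qed.

Lemma even_sitesP l v : v \in even_sites l ->
  parity v = false /\ v \in box (0, 0) l.*2.-1.
Proof.
move=> /allpairsP[[i j] /= [hi hj ->]]; move: hi hj; rewrite !mem_iota => hi hj.
split; first by rewrite /parity /=; lia.
rewrite in_box /=; lia.
Qed.

Lemma box_sub_even l u : u \in box (0, 0) l.*2.-1 ->
  (box (0, 0) l.*2.-1.+1 `<=` box u l.*2.*2.+1)%fset.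
Proof. by rewrite in_box /= => /andP[h1 h2]; apply: box_sub => /=; lia. Qed.

(** The count is 4 * (2 * (2l - 1) + 3) = 16l + 4, at most 20l since l >= 1. *)
Lemma card_boundary_even l : (0 < l)%N ->
  (#|` (box (0%R, 0%R) l.*2.-1.+1 `\` core (box (0%R, 0%R) l.*2.-1.+1))%fset| <= 20 * l)%N.
Proof. by move=> l0; apply: leq_trans (card_box_boundary _ _) _; lia. Qed.

Lemma bernoulli_ineq (R : realDomainType) (t : R) n : 0 <= t <= 1 ->
  1 - n%:R * t <= (1 - t) ^+ n.
Proof.
move=> /andP[t0 t1]; elim: n => [|n IH]; first by rewrite mul0r subr0 expr0.
rewrite exprS; apply: le_trans (_ : (1 - t) * (1 - n%:R * t) <= _); last first.
  by rewrite ler_wpM2l // subr_ge0.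
rewrite -subr_ge0 (_ : _ - _ = n%:R * t ^+ 2); last by rewrite -natr1; ring.
by rewrite mulr_ge0 ?sqr_ge0.
Qed.

(** * Expectations over the environment and tilted laws *)

Section tilting.
Context d (T : measurableType d) (R : realType) (P : probability T R).
Variable Y : Z2 -> T -> R.
Hypothesis mY : forall v, measurable_fun setT (Y v).
Hypothesis Y_ind : forall (F : {fset Z2}) (B : Z2 -> set R), (forall v, measurable (B v)) ->
  P (\bigcap_(v in [set` F]) (Y v @^-1` B v)) = (\prod_(v <- F) P (Y v @^-1` B v))%E.
Hypothesis Y_id : forall u v (B : set R), measurable B -> P (Y u @^-1` B) = P (Y v @^-1` B).
Hypothesis Y_ge0 : forall v w, 0 <= Y v w.
Implicit Types (F G : env R -> R) (x : env R).

Definition nonneg_env (x : env R) : Prop := forall v, 0 <= x v.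

Lemma field_ge0 w : nonneg_env (field Y w).
Proof. by move=> v; exact: Y_ge0. Qed.

(** Nonnegativity is required on nonnegative environments only: the field takes its values there,
    and gaps and free energies have no sign elsewhere. *)
Definition nice (F : env R -> R) : Prop :=
  [/\ measurable_fun setT F, (forall x, nonneg_env x -> 0 <= F x) &
      P.-integrable setT (fun w => (F (field Y w))%:E)].

Definition Ex (F : env R -> R) : R := (\int[P]_w F (field Y w))%R.

Definition ignores u (F : env R -> R) : Prop := forall x y, F (update x u y) = F x.

Lemma measurable_comp_field (F : env R -> R) : measurable_fun setT F ->
  measurable_fun setT (fun w => F (field Y w)).
Proof. by move=> mF; exact: measurableT_comp mF (measurable_field mY). Qed.

Lemma nice_le F G : nice G -> measurable_fun setT F ->
  (forall x, nonneg_env x -> 0 <= F x <= G x) -> nice F.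
Proof.
move=> [mG G0 iG] mF FG; split => //; first by move=> x /FG /andP[].
apply: le_integrable iG => //.
  by apply/measurable_EFinP; exact: measurable_comp_field.
move=> w _; have /andP[F0 FG'] := FG _ (field_ge0 w).
by rewrite !abse_EFin lee_fin ger0_norm // (le_trans FG') // ler_norm.
Qed.

Lemma nice_cst r : 0 <= r -> nice (fun=> r).
Proof.
move=> r0; split => //.
exact: finite_measure_integrable_cst.
Qed.

Lemma nice_bounded F (c : R) : measurable_fun setT F ->
  (forall x, nonneg_env x -> 0 <= F x <= c) -> nice F.
Proof.
move=> mF Fc; have c0 : 0 <= c.
  by have /andP[h1 h2] := Fc _ (field_ge0 point); exact: le_trans h1 h2.
exact: nice_le (nice_cst c0) mF Fc.
Qed.

Lemma niceD F G : nice F -> nice G -> nice (fun x => F x + G x).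
Proof.
move=> [mF F0 iF] [mG G0 iG]; split.
- exact: measurable_funD.
- by move=> x x0; rewrite addr_ge0 ?F0 ?G0.
- exact: (integrableD measurableT iF iG).
Qed.

Lemma niceZ (r : R) F : 0 <= r -> nice F -> nice (fun x => r * F x).
Proof.
move=> r0 [mF F0 iF]; split.
- by apply: measurable_funM => //; exact: measurable_cst.
- by move=> x x0; rewrite mulr_ge0 ?F0.
- exact: (integrableZl measurableT r iF).
Qed.

Lemma niceM F G (c : R) : nice F -> measurable_fun setT G ->
  (forall x, nonneg_env x -> 0 <= G x <= c) -> nice (fun x => F x * G x).
Proof.
move=> nF mG Gc; have c0 : 0 <= c.
  by have /andP[h1 h2] := Gc _ (field_ge0 point); exact: le_trans h1 h2.
apply: nice_le (niceZ c0 nF) _ _.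
  by apply: measurable_funM => //; case: nF.
move=> x x0; have [_ F0 _] := nF; have /andP[G0 Gx] := Gc _ x0.
by rewrite mulr_ge0 ?F0 //= mulrC ler_wpM2r ?F0.
Qed.

Lemma le_Ex F G : nice F -> nice G -> (forall x, nonneg_env x -> F x <= G x) ->
  Ex F <= Ex G.
Proof.
move=> [_ _ iF] [_ _ iG] FG; apply: le_Rintegral => // w _.
by apply: FG; exact: field_ge0.
Qed.

Lemma eq_Ex F G : (forall x, nonneg_env x -> F x = G x) -> Ex F = Ex G.
Proof. by move=> FG; apply: eq_Rintegral => w _; apply: FG; exact: field_ge0. Qed.

Lemma ExD F G : nice F -> nice G -> Ex (fun x => F x + G x) = Ex F + Ex G.
Proof. by move=> [_ _ iF] [_ _ iG]; exact: RintegralD. Qed.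

Lemma ExZ r F : nice F -> Ex (fun x => r * F x) = r * Ex F.
Proof. by move=> [_ _ iF]; exact: RintegralZl. Qed.

Lemma Ex_ge0 F : nice F -> 0 <= Ex F.
Proof. by move=> [_ F0 _]; apply: Rintegral_ge0 => w _; apply: F0; exact: field_ge0. Qed.

Lemma Ex_cst r : Ex (fun=> r) = r.
Proof.
rewrite /Ex Rintegral_cst // -[RHS]mulr1; congr (_ * _).
exact: (congr1 fine (probability_setT P)).
Qed.

Definition prob (B : set R) : R := fine (P (Y (0, 0) @^-1` B)).

Lemma Ex_indep u F (B : set R) : nice F -> ignores u F -> measurable B ->
  Ex (fun x => F x * \1_B (x u)) = prob B * Ex F.
Proof.
move=> [mF F0 iF] Fu mB.
(* [integral_indep] asks for nonnegativity on all environments; truncating the coordinates at 0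
   provides it without changing the values on the field. *)
pose clip (x : env R) : env R := fun v => Num.max (x v) 0.
have mclip : measurable_fun setT clip.
  apply: measurable_env => v; apply: measurable_maxr; last exact: measurable_cst.
  exact: measurable_coordinate.
have clip_ge0 x : nonneg_env (clip x) by move=> v; rewrite /clip le_max lexx orbT.
have clipE w : clip (field Y w) = field Y w.
  by apply/funext => v; rewrite /clip; apply/max_idPl; exact: Y_ge0.
have := @integral_indep _ _ _ P Y mY Y_ind u (fun x => F (clip x)) B
  (measurableT_comp mF mclip) (fun x => F0 _ (clip_ge0 x)) _ mB.
have clip_upd x y : F (clip (update x u y)) = F (clip x).
  rewrite -(Fu (clip x) (Num.max y 0)); congr F; apply/funext => v.
  by rewrite /clip /update; case: eqP.
move=> /(_ clip_upd).
under eq_integral do rewrite clipE.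
under [in X in _ = (_ * X)%E]eq_integral do rewrite clipE.
rewrite (Y_id u (0, 0) mB) => /(congr1 fine).
rewrite fineM ?fin_num_measure //; first last.
- exact: integrable_fin_num.
- by rewrite -[X in measurable X]setTI; exact: mY.
Qed.

Variables a b : R.
Hypothesis a_ge0 : 0 <= a.
Hypothesis ab : a < b.
Let low : set R := [set y | y <= a].
Let high : set R := [set y | b <= y].
Hypothesis low_gt0 : 0 < prob low.
Hypothesis high_gt0 : 0 < prob high.

Let b_ge0 : 0 <= b. Proof. exact: le_trans a_ge0 (ltW ab). Qed.

Let mlow : measurable low.
Proof. by rewrite /low -set_itvNyc; exact: measurable_itv. Qed.

Let mhigh : measurable high.
Proof. by rewrite /high -set_itvcy; exact: measurable_itv. Qed.

(* The score has mean zero, and positive correlation with increasing functions. *)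
Definition score (y : R) : R := \1_high y / prob high - \1_low y / prob low.

Let K : R := (prob high)^-1 + (prob low)^-1.

Lemma score_bound_gt0 : 0 < K.
Proof. by rewrite addr_gt0 ?invr_gt0. Qed.

Lemma score_bound y : - K <= score y <= K.
Proof.
rewrite /score /K !indicE.
have h1 : 0 < (prob high)^-1 by rewrite invr_gt0.
have h2 : 0 < (prob low)^-1 by rewrite invr_gt0.
by case: (y \in high); case: (y \in low); rewrite ?mul1r ?mul0r; apply/andP; split; lra.
Qed.

Lemma measurable_indic_coordinate u (B : set R) : measurable B ->
  measurable_fun setT (fun x => \1_B (x u) : R).
Proof.
move=> mB; have mc := @measurable_coordinate R u.
have mi : measurable_fun setT (\1_B : R -> R) by exact: measurable_indic.
exact: (measurableT_comp mi mc).
Qed.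

Lemma measurable_score u : measurable_fun setT (fun x => score (x u)).
Proof.
apply: measurable_funB; apply: measurable_funM => //.
- exact: measurable_indic_coordinate.
- exact: measurable_indic_coordinate.
Qed.

Lemma indic01 (B : set R) y : 0 <= (\1_B y : R) <= 1.
Proof. by rewrite indicE; case: (_ \in _); rewrite ?lexx ler01. Qed.

Lemma nice_indic u F (B : set R) : measurable B -> nice F ->
  nice (fun x => F x * \1_B (x u)).
Proof.
move=> mB nF; apply: (niceM nF (c := 1)); first exact: measurable_indic_coordinate.
by move=> x _; exact: indic01.
Qed.

(** The score at [u] is independent of [F] and has mean zero. Its negative half is moved to the
    left-hand side so that every term stays [nice]. *)
Lemma Ex_tilt (delta : R) u F : 0 <= delta -> delta * K <= 1 -> nice F -> ignores u F ->
  Ex (fun x => F x * (1 + delta * score (x u))) = Ex F.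
Proof.
move=> d0 dK nF Fu.
have nlow := nice_indic u mlow nF; have nhigh := nice_indic u mhigh nF.
have dh : 0 <= delta / prob high by rewrite divr_ge0 // ltW.
have dl : 0 <= delta / prob low by rewrite divr_ge0 // ltW.
have nt : nice (fun x => F x * (1 + delta * score (x u))).
  apply: (niceM nF (c := 2)).
    apply: measurable_funD => //; apply: measurable_funM => //; exact: measurable_score.
  move=> x _; have /andP[s1 s2] := score_bound (x u).
  have h1 : delta * score (x u) <= delta * K by rewrite ler_wpM2l.
  have h2 : - (delta * K) <= delta * score (x u) by rewrite -mulrN ler_wpM2l.
  by apply/andP; split; lra.
have : Ex (fun x => F x * (1 + delta * score (x u))) +
    Ex (fun x => delta / prob low * (F x * \1_low (x u))) =
    Ex F + Ex (fun x => delta / prob high * (F x * \1_high (x u))).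
  rewrite -ExD //; last exact: niceZ.
  rewrite -ExD //; last exact: niceZ.
  by apply: eq_Ex => x _; rewrite /score; field; rewrite !gt_eqF.
rewrite !ExZ // !(Ex_indep nF Fu) // mulrA divfK ?gt_eqF // mulrA divfK ?gt_eqF //.
exact: addIr.
Qed.

Section small_tilt.
Variable delta : R.
Hypothesis delta_ge0 : 0 <= delta.
Hypothesis delta_small : 2 * delta * K <= 1.

Let tilt u x : R := 1 + delta * score (x u).

Definition density (s : seq Z2) x : R := \prod_(u <- s) tilt u x.

Let dK : delta * K <= 1.
Proof.
have : 0 <= delta * K by rewrite mulr_ge0 // ltW // score_bound_gt0.
by move: delta_small; lra.
Qed.

Lemma tilt_bounds u x : 1 - delta * K <= tilt u x <= 1 + delta * K.
Proof.
have /andP[s1 s2] := score_bound (x u).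
by rewrite !lerD2l ler_wpM2l // -mulrN ler_wpM2l.
Qed.

Lemma tilt_ge0 u x : 0 <= tilt u x.
Proof. by have /andP[h _] := tilt_bounds u x; apply: le_trans h; rewrite subr_ge0. Qed.

Lemma density_bounds s x : 0 <= density s x <= 2 ^+ size s.
Proof.
elim: s => [|u s /andP[IH1 IH2]]; rewrite /density ?big_nil ?lexx ?ler01 //=.
rewrite big_cons -/(density s x) mulr_ge0 ?tilt_ge0 //= exprS.
apply: ler_pM => //; first exact: tilt_ge0.
by have /andP[_ h] := tilt_bounds u x; apply: le_trans h _; rewrite -[2]/(1 + 1) lerD2l.
Qed.

Lemma measurable_density s : measurable_fun setT (density s).
Proof.
elim: s => [|u s IH].
  by rewrite (_ : density [::] = cst 1) //; apply/funext => x; rewrite /density big_nil.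
rewrite (_ : density (u :: s) = fun x => tilt u x * density s x); last first.
  by apply/funext => x; rewrite /density big_cons.
apply: measurable_funM => //; apply: measurable_funD => //.
by apply: measurable_funM => //; exact: measurable_score.
Qed.

Lemma density_ignores u s : u \notin s -> ignores u (density s).
Proof.
move=> us x y; rewrite /density !big_seq; apply: eq_bigr => v vs.
rewrite /tilt /update; case: eqP => // vu.
by move: us; rewrite -vu vs.
Qed.

Lemma nice_density F s : nice F -> nice (fun x => F x * density s x).
Proof.
move=> nF; apply: niceM nF (measurable_density s) _ => x _; exact: density_bounds.
Qed.

Lemma ignoresM u F G : ignores u F -> ignores u G -> ignores u (fun x => F x * G x).
Proof. by move=> hF hG x y; rewrite hF hG. Qed.

Lemma Ex_density_ignores F s : nice F -> (forall u, u \in s -> ignores u F) -> uniq s ->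
  Ex (fun x => F x * density s x) = Ex F.
Proof.
move=> nF; elim: s => [|u s IH] hs /=.
  by move=> _; apply: eq_Ex => x _; rewrite /density big_nil mulr1.
move=> /andP[us uniqs]; rewrite -IH //; last by move=> v vs; apply: hs; rewrite inE vs orbT.
rewrite -[RHS](@Ex_tilt delta u) //; first last.
- by apply: ignoresM; [apply: hs; exact: mem_head|exact: density_ignores].
- exact: nice_density.
by apply: eq_Ex => x _; rewrite /density big_cons mulrCA mulrC.
Qed.

(** A factor at a site that [F] ignores leaves the mean unchanged, by [Ex_tilt]; any other factor is
    at least [1 - delta * K] pointwise. *)
Lemma Ex_density_local F (D : pred Z2) s : nice F -> (forall u, ~~ D u -> ignores u F) ->
  uniq s -> (1 - delta * K) ^+ count D s * Ex F <= Ex (fun x => F x * density s x).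
Proof.
move=> nF hD; elim: s => [|u s IH] /=.
  move=> _; rewrite expr0 mul1r (@eq_Ex (fun x => F x * density [::] x) F) //.
  by move=> x _; rewrite /density big_nil mulr1.
move=> /andP[us uniqs]; have {}IH := IH uniqs.
have eE : Ex (fun x => F x * density (u :: s) x) =
    Ex (fun x => F x * density s x * (1 + delta * score (x u))).
  by apply: eq_Ex => x _; rewrite /density big_cons mulrCA mulrC.
rewrite eE; case: (boolP (D u)) => Du; last first.
  rewrite add0n Ex_tilt //; first exact: nice_density.
  by apply: ignoresM; [exact: hD|exact: density_ignores].
rewrite exprS -mulrA; apply: (@le_trans _ _ ((1 - delta * K) * Ex (fun x => F x * density s x))).
  by rewrite ler_wpM2l // subr_ge0.
rewrite -ExZ; last exact: nice_density.
apply: le_Ex.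
- by apply: niceZ; [rewrite subr_ge0|exact: nice_density].
- apply: (niceM (nice_density s nF) (c := 2)).
    apply: measurable_funD => //; apply: measurable_funM => //; exact: measurable_score.
  move=> x _; rewrite -/(tilt u x) tilt_ge0 /=.
  by have /andP[_ h] := tilt_bounds u x; apply: le_trans h _; rewrite -[2]/(1 + 1) lerD2l.
- move=> x x0; rewrite mulrC ler_wpM2l //.
    have [_ F0 _] := nF; have /andP[h _] := density_bounds s x.
    by rewrite mulr_ge0 ?F0.
  by have /andP[h _] := tilt_bounds u x.
Qed.

(** In the square of [1 + delta * score], the part [1 + 2 * delta * score] is again a tilt and
    leaves the mean unchanged, so only the quadratic term counts. The factor 2 in [delta_small]
    makes this doubled tilt nonnegative. *)
Lemma Ex_density_sqr s : uniq s ->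
  Ex (fun x => density s x ^+ 2) <= (1 + (delta * K) ^+ 2) ^+ size s.
Proof.
have nsq t : nice (fun x => density t x ^+ 2).
  apply: (nice_bounded (c := (2 ^+ size t) ^+ 2)).
    by apply: measurable_funX; exact: measurable_density.
  move=> x _; have /andP[h1 h2] := density_bounds t x.
  by rewrite sqr_ge0 /= lerXn2r ?nnegrE // (le_trans h1).
elim: s => [|u s IH] /=.
  by move=> _; rewrite (@eq_Ex _ (fun=> 1)) ?Ex_cst // => x _; rewrite /density big_nil expr1n.
move=> /andP[us uniqs]; have {}IH := IH uniqs.
have i2 : ignores u (fun x => density s x ^+ 2).
  by move=> x y; rewrite (density_ignores us).
have d2 : 0 <= 2 * delta by rewrite mulr_ge0.
have nt : nice (fun x => density s x ^+ 2 * (1 + 2 * delta * score (x u))).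
  apply: (niceM (nsq s) (c := 2)).
    apply: measurable_funD => //; apply: measurable_funM => //; exact: measurable_score.
  move=> x _; have /andP[s1 s2] := score_bound (x u).
  have h1 : 2 * delta * score (x u) <= 2 * delta * K by rewrite ler_wpM2l.
  have h2 : - (2 * delta * K) <= 2 * delta * score (x u) by rewrite -mulrN ler_wpM2l.
  by have h3 := delta_small; apply/andP; split; lra.
apply: (@le_trans _ _ (Ex (fun x => density s x ^+ 2 * (1 + 2 * delta * score (x u))) +
    Ex (fun x => (delta * K) ^+ 2 * density s x ^+ 2))).
  rewrite -ExD //; last by apply: niceZ => //; exact: sqr_ge0.
  apply: le_Ex => //.
    by apply: niceD => //; apply: niceZ => //; exact: sqr_ge0.
  move=> x _; rewrite /density big_cons -/(density s x) exprMn -/(tilt u x).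
  rewrite [X in _ + X]mulrC -mulrDr mulrC ler_wpM2l ?sqr_ge0 //.
  have : (delta * score (x u)) ^+ 2 <= (delta * K) ^+ 2.
    have /andP[s1 s2] := score_bound (x u).
    rewrite !exprMn ler_wpM2l ?sqr_ge0 // -subr_ge0 subr_sqr mulr_ge0 //; lra.
  by rewrite /tilt; lra.
rewrite Ex_tilt // ExZ // -[X in X + _]mul1r -mulrDl [leRHS]exprS ler_wpM2l //.
by rewrite addr_ge0 ?sqr_ge0.
Qed.

(** The new factor adds [delta] times the mean of [score * G]. By monotonicity [G] is at least its
    value at [b] on [high] and at most its value at [a] on [low]; these values do not involve the
    coordinate [u], so the normalised indicators average out and the increment [c * D] is left. *)
Lemma Ex_density_step (G D : env R -> R) (c : R) u s :
  nice G -> nice (fun x => G (update x u a)) -> nice (fun x => G (update x u b)) -> nice D ->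
  0 <= c -> u \notin s ->
  (forall x, nonneg_env x -> forall y y', 0 <= y -> y <= y' ->
    G (update x u y) <= G (update x u y')) ->
  (forall x, nonneg_env x -> G (update x u a) + c * D x <= G (update x u b)) ->
  Ex (fun x => G x * density s x) + delta * c * Ex (fun x => D x * density s x) <=
  Ex (fun x => G x * density (u :: s) x).
Proof.
move=> nG nGa nGb nD c0 us mono incr.
pose Ga x := G (update x u a) * density s x; pose Gb x := G (update x u b) * density s x.
have nGa' : nice Ga := nice_density s nGa; have nGb' : nice Gb := nice_density s nGb.
have ign y : ignores u (fun x => G (update x u y) * density s x).
  apply: ignoresM (density_ignores us) => x z; congr G; apply/funext => v.
  by rewrite /update; case: eqP.
have dh : 0 <= delta / prob high by rewrite divr_ge0 // ltW.
have dl : 0 <= delta / prob low by rewrite divr_ge0 // ltW.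
have nlow := nice_indic u mlow nGa'; have nhigh := nice_indic u mhigh nGb'.
have h1 : Ex (fun x => G x * density s x) + delta * Ex Gb <=
    Ex (fun x => G x * density (u :: s) x) + delta * Ex Ga.
  have -> : delta * Ex Gb = Ex (fun x => delta / prob high * (Gb x * \1_high (x u))).
    by rewrite ExZ // (Ex_indep nGb' (ign b)) // mulrA divfK ?gt_eqF.
  have -> : delta * Ex Ga = Ex (fun x => delta / prob low * (Ga x * \1_low (x u))).
    by rewrite ExZ // (Ex_indep nGa' (ign a)) // mulrA divfK ?gt_eqF.
  have n1 := nice_density s nG; have n2 := nice_density (u :: s) nG.
  have n3 := niceZ dh nhigh; have n4 := niceZ dl nlow.
  rewrite -!ExD //; apply: le_Ex; [exact: niceD|exact: niceD|move=> x x0].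
  rewrite /density big_cons -/(density s x) /tilt /Ga /Gb.
  have /andP[H0 _] := density_bounds s x.
  have xu : update x u (x u) = x by apply/funext => v; rewrite /update; case: eqP => // ->.
  have key : delta / prob high * \1_high (x u) * G (update x u b) <=
      delta * score (x u) * G x + delta / prob low * \1_low (x u) * G (update x u a).
    have hb : \1_high (x u) * G (update x u b) <= \1_high (x u) * G x.
      rewrite indicE; case: (boolP (_ \in _)) => [/set_mem|]; rewrite ?mul0r // !mul1r.
      by move=> bx; rewrite -[in leRHS]xu mono.
    have ha : \1_low (x u) * G x <= \1_low (x u) * G (update x u a).
      rewrite indicE; case: (boolP (_ \in _)) => [/set_mem|]; rewrite ?mul0r // !mul1r.
      by move=> xa; rewrite -[in leLHS]xu mono.
    have := ler_wpM2l dh hb; have := ler_wpM2l dl ha.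
    have -> : delta * score (x u) * G x = delta / prob high * (\1_high (x u) * G x) -
      delta / prob low * (\1_low (x u) * G x) by rewrite /score; ring.
    by rewrite !mulrA; lra.
  have := ler_wpM2r H0 key; lra.
have h2 : Ex Ga + c * Ex (fun x => D x * density s x) <= Ex Gb.
  have nDs := nice_density s nD.
  rewrite -ExZ // -ExD //; last exact: niceZ.
  apply: le_Ex => //; first by apply: niceD => //; exact: niceZ.
  move=> x x0; have /andP[H0 _] := density_bounds s x.
  by have := ler_wpM2r H0 (incr _ x0); rewrite /Ga /Gb; lra.
have := ler_wpM2l delta_ge0 h2; lra.
Qed.

End small_tilt.

(** * Free energy gain against boundary cost *)

Hypothesis Y_int : forall v, P.-integrable setT (fun w => (Y v w)%:E).

Lemma nice_coordinate v : nice (fun x => x v).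
Proof. by split; [exact: measurable_coordinate|move=> x; exact|exact: Y_int]. Qed.

Lemma Ex_sum (I : Type) (s : seq I) (F : I -> env R -> R) : (forall i, nice (F i)) ->
  nice (fun x => \sum_(i <- s) F i x) /\
  Ex (fun x => \sum_(i <- s) F i x) = \sum_(i <- s) Ex (F i).
Proof.
move=> nF; elim: s => [|i s [nS IH]].
  rewrite (_ : (fun x => _) = fun=> 0); last by apply/funext => x; rewrite big_nil.
  by rewrite big_nil Ex_cst; split => //; exact: nice_cst.
rewrite (_ : (fun x => _) = fun x => F i x + \sum_(j <- s) F j x); last first.
  by apply/funext => x; rewrite big_cons.
by rewrite big_cons ExD // IH; split => //; exact: niceD.
Qed.

Lemma Ex_shift t F : nice F -> Ex F = Ex (fun x => F (fun v => x (translate t v))).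
Proof.
move=> [mF F0 _]; congr fine.
have mF' : measurable_fun setT (fun x => Num.max (F x) 0).
  by apply: measurable_maxr => //; exact: measurable_cst.
have := @integral_shift _ _ _ P Y mY Y_ind Y_id t (fun x => Num.max (F x) 0) mF'.
have F0' x : 0 <= Num.max (F x) 0 by rewrite le_max lexx orbT.
move=> /(_ F0'); congr (_ = _); apply: eq_integral => w _; congr EFin; apply/max_idPl;
  by apply: F0 => v; exact: Y_ge0.
Qed.

Let mean : R := Ex (fun x => x (0, 0)).

Lemma Ex_coordinate v : Ex (fun x => x v) = mean.
Proof.
rewrite /mean (Ex_shift v (nice_coordinate (0, 0))); apply: eq_Ex => x _.
by congr (x _); case: v => v1 v2; rewrite /translate /= !add0r.
Qed.

Lemma mean_ge0 : 0 <= mean.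
Proof. exact: Ex_ge0 (nice_coordinate _). Qed.

Lemma nice_gap L v : (forall u, adj v u -> u \in L) -> nice (fun x => gap x L v).
Proof.
move=> nL; apply: (nice_bounded (c := 1)); first exact: measurable_gap.
by move=> x x0; rewrite gap_ge0 // gap_le1.
Qed.

Lemma nice_gap_box v k : nice (fun x => gap_box x v k).
Proof. by apply: nice_gap => u; exact: adj_box. Qed.

Definition mean_gap k : R := Ex (fun x => gap_box x (0, 0) k).

Lemma Ex_gap_box v k : Ex (fun x => gap_box x v k) = mean_gap k.
Proof.
rewrite /mean_gap (Ex_shift v (nice_gap_box (0, 0) k)); apply: eq_Ex => x _.
by rewrite gap_box_shift.
Qed.

(** The rate in [free_diff_update] when an activity is raised from [a] to [b]. *)
Let c : R := (b - a) / ((1 + a) * (1 + b)).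

Let c_ge0 : 0 <= c.
Proof. by rewrite divr_ge0 ?subr_ge0 ?(ltW ab) // mulr_ge0 // addr_ge0. Qed.

Section one_scale.
Variable delta : R.
Hypothesis delta_ge0 : 0 <= delta.
Hypothesis delta_small : 2 * delta * K <= 1.

(* The gap in [L] lies above the gap in a box of size [n], hence, in mean and up
   to a small error, above the gap in a box of bounded size [k].  The density is
   transferred to this error with 2 x h <= x^2 / theta + theta h^2. *)
Lemma Ex_gap_density L v s k n (theta : R) : 0 < theta -> uniq s -> (k <= n)%N ->
  (forall u, adj v u -> u \in L) -> (L `<=` box v n.+1)%fset ->
  (1 - delta * K) ^+ #|` box (0, 0) k.+1| * mean_gap k <=
  Ex (fun x => gap x L v * density delta s x) + (2 * theta)^-1 * (mean_gap k - mean_gap n) +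
  theta / 2 * (1 + (delta * K) ^+ 2) ^+ size s.
Proof.
have key (z u t y m m' q q' : R) : y + t * m' <= u + t * m + q -> z <= y -> q <= q' ->
  z <= u + t * (m - m') + q' by move=> *; lra.
move=> th0 us kn nL Ln.
have th1 : 0 <= (2 * theta)^-1 by rewrite invr_ge0 mulr_ge0 // ltW.
have th2 : 0 <= theta / 2 by rewrite divr_ge0 // ltW.
have dK : 0 <= 1 - delta * K <= 1.
  have : 0 <= delta * K by rewrite mulr_ge0 // ltW // score_bound_gt0.
  by move: delta_small; lra.
have nk := nice_gap_box v k; have nn := nice_gap_box v n; have nL' := nice_gap nL.
have nkd := nice_density delta_ge0 delta_small s nk.
have nLd := nice_density delta_ge0 delta_small s nL'.
have nsq : nice (fun x => density delta s x ^+ 2).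
  apply: (nice_bounded (c := (2 ^+ size s) ^+ 2)).
    by apply: measurable_funX; exact: measurable_density.
  move=> x _; have /andP[h1 h2] := density_bounds delta_ge0 delta_small s x.
  by rewrite sqr_ge0 /= lerXn2r ?nnegrE // (le_trans h1).
have n1 := niceZ th1 nn; have n2 := niceZ th1 nk; have n3 := niceZ th2 nsq.
have h1 : Ex (fun x => gap_box x v k * density delta s x) + (2 * theta)^-1 * mean_gap n <=
    Ex (fun x => gap x L v * density delta s x) + (2 * theta)^-1 * mean_gap k +
    theta / 2 * Ex (fun x => density delta s x ^+ 2).
  have n12 := niceD nLd n2; have n13 := niceD n12 n3; have n01 := niceD nkd n1.
  have e1 := ExD nkd n1; rewrite (ExZ (2 * theta)^-1 nn) (Ex_gap_box v n) in e1.
  have e2 := ExD nLd n2; rewrite (ExZ (2 * theta)^-1 nk) (Ex_gap_box v k) in e2.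
  have e3 := ExD n12 n3; rewrite e2 (ExZ (theta / 2) nsq) in e3.
  have := le_Ex n01 n13; rewrite e1 e3; apply => x x0 {e1 e2 e3}.
  have g1 : gap_box x v n <= gap x L v by apply: gap_antitone.
  have g2 := gap_box_antitone v x0 kn.
  have g3 : 0 <= gap_box x v n by exact: gap_box_ge0.
  have g4 : gap_box x v k <= 1 by exact: gap_le1.
  have /andP[H0 _] := density_bounds delta_ge0 delta_small s x.
  move: (gap_box x v n) (gap_box x v k) (gap x L v) (density delta s x) g1 g2 g3 g4 H0.
  move=> an ak aL h g1 g2 g3 g4 H0.
  have h2 : an * h <= aL * h by rewrite ler_wpM2r.
  (* The square of [ak - an] is at most [ak - an], which lies in [0, 1]; the error becomes linear in
     the gaps, and its mean is a difference of mean gaps. *)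
  have h3 : (ak - an) * h <= (2 * theta)^-1 * (ak - an) + theta / 2 * h ^+ 2.
    apply: (@le_trans _ _ ((2 * theta)^-1 * (ak - an) ^+ 2 + theta / 2 * h ^+ 2)).
      rewrite -subr_ge0 (_ : _ - _ = (2 * theta)^-1 * ((ak - an) - theta * h) ^+ 2).
        by rewrite mulr_ge0 ?sqr_ge0.
      by field; rewrite gt_eqF.
    rewrite lerD2r ler_wpM2l // expr2 ler_piMl //; lra.
  lra.
have h2 : (1 - delta * K) ^+ #|` box (0, 0) k.+1| * mean_gap k <=
    Ex (fun x => gap_box x v k * density delta s x).
  apply: le_trans (Ex_density_local delta_ge0 delta_small (D := mem (box v k.+1)) nk _ us).
    rewrite Ex_gap_box ler_wpM2r //; first by rewrite -(Ex_gap_box v) Ex_ge0.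
    have /andP[d1 d2] := dK; apply: ler_wiXn2l => //.
    rewrite -(card_box v) -size_filter; apply: uniq_leq_size; first exact: filter_uniq.
    by move=> u; rewrite mem_filter => /andP[].
  move=> u nu x y; apply: eq_gap => z zL; rewrite /update; case: eqP => // zu.
  by move: nu; rewrite -zu /= zL.
have h3 := Ex_density_sqr delta_ge0 delta_small us.
exact: key h1 h2 (ler_wpM2l th2 h3).
Qed.

(** Each site added to the tilt raises the mean of [G] by at least [delta * c * g0], starting from a
    nonnegative value. The final mean is at most that of [2 * B], which the tilt leaves unchanged
    because [B] ignores the core. *)
Lemma free_energy_bound L s (g0 : R) : uniq s ->
  (forall u, u \in s -> parity u = false /\ u \in core L) ->
  (forall u t, u \in s -> uniq t -> {subset t <= s} ->
     g0 <= Ex (fun x => gap x L u * density delta t x)) ->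
  delta * c * g0 *+ size s <= 2 * (mean *+ #|` (L `\` core L)%fset|).
Proof.
move=> us hs hg; pose bdry := (L `\` core L)%fset.
pose B x := \sum_(v <- bdry) x v.
(* Adding [B] makes the free energy difference nonnegative without affecting its increments at sites
   of the core. *)
pose G x := free_diff x L false + B x.
have [nB eB] := Ex_sum bdry nice_coordinate; rewrite -/B in nB eB.
have mG : measurable_fun setT G.
  by apply: measurable_funD; [exact: measurable_free_diff|case: nB].
have GB x : nonneg_env x -> 0 <= G x <= 2 * B x.
  move=> x0; have := free_diff_bound x0 L false; rewrite -/bdry -/(B x) ler_norml /G.
  by move=> /andP[h1 h2]; apply/andP; split; lra.
have n2B : nice (fun x => 2 * B x) by exact: niceZ.
have nG : nice G := nice_le n2B mG GB.
have B_ignores u : u \in core L -> ignores u B.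
  move=> uL x y; rewrite /B !big_seq; apply: eq_bigr => v vb.
  rewrite /update; case: eqP => // vu; move: vb.
  by rewrite vu inE uL.
have nGy u y : u \in s -> 0 <= y -> nice (fun x => G (update x u y)).
  move=> us' y0; have [_ uL] := hs _ us'.
  apply: (nice_le n2B).
    apply: measurableT_comp mG _; apply: measurable_env => v; rewrite /update.
    by case: eqP => _; [exact: measurable_cst|exact: measurable_coordinate].
  move=> x x0; have /GB : nonneg_env (update x u y) by exact: update_ge0.
  by rewrite (B_ignores _ uL).
have incr u x y y' : u \in s -> nonneg_env x -> 0 <= y -> y <= y' ->
    G (update x u y) + (y' - y) / ((1 + y) * (1 + y')) * gap x L u <= G (update x u y').
  move=> us' x0 y0 yy'; have [pu uL] := hs _ us'.
  have := free_diff_update x0 y0 yy' uL; rewrite pu /G !(B_ignores _ uL); lra.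
have nLs u : u \in s -> forall v, adj u v -> v \in L.
  by move=> /hs[_ uL] v; exact: core_adj uL.
have step t : uniq t -> {subset t <= s} ->
    delta * c * g0 *+ size t <= Ex (fun x => G x * density delta t x).
  elim: t => [|u t IH] /=.
    by move=> _ _; rewrite mulr0n; apply: Ex_ge0; exact: nice_density.
  move=> /andP[ut unt] sub; have us' : u \in s by apply: sub; exact: mem_head.
  have sub' : {subset t <= s} by move=> v vt; apply: sub; rewrite inE vt orbT.
  have := Ex_density_step delta_ge0 delta_small nG (nGy _ _ us' a_ge0) (nGy _ _ us' b_ge0)
    (nice_gap (nLs _ us')) c_ge0 ut.
  have mono x : nonneg_env x -> forall y y', 0 <= y -> y <= y' ->
    G (update x u y) <= G (update x u y').
    move=> x0 y y' y0 yy'; apply: le_trans (incr _ _ _ _ us' x0 y0 yy').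
    rewrite lerDl mulr_ge0 ?gap_ge0 //; last exact: nLs.
    rewrite divr_ge0 ?subr_ge0 // mulr_ge0 // addr_ge0 //; exact: le_trans yy'.
  have inc x : nonneg_env x -> G (update x u a) + c * gap x L u <= G (update x u b).
    by move=> x0; exact: incr (ltW ab).
  move=> /(_ mono inc) h; apply: (le_trans _ h); rewrite mulrSr; apply: lerD; first exact: IH.
  by apply: ler_wpM2l; [exact: mulr_ge0|exact: hg].
apply: le_trans (step s us (fun _ => id)) _.
apply: (@le_trans _ _ (Ex (fun x => 2 * B x * density delta s x))).
  apply: le_Ex; [exact: nice_density|exact: nice_density|move=> x x0].
  have /andP[H0 _] := density_bounds delta_ge0 delta_small s x.
  by rewrite ler_wpM2r //; case/andP: (GB x x0).
rewrite Ex_density_ignores //; last first.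
  by move=> u /hs[_ uL] x y; rewrite (B_ignores _ uL).
rewrite ExZ // eB ler_pM2l //.
under eq_bigr do rewrite Ex_coordinate.
by rewrite big_const_seq count_predT iter_addr_0.
Qed.

End one_scale.

Lemma mean_gap_vanishes (e : R) : 0 < e -> exists k, mean_gap k < e.
Proof.
(* The local tilt keeps 3/4 of the mean gap, and each of the two error terms takes 1/8: half of it
   survives. *)
have key (m' X p q r : R) : 3 / 4 * m' <= p -> q <= m' / 8 -> r <= m' / 8 ->
  p <= X + q + r -> m' / 2 <= X by move=> *; lra.
move=> e0; apply: contrapT => /forallNP he.
have {}he k : e <= mean_gap k by rewrite leNgt; apply/negP; exact: he.
have hinf : has_inf (range mean_gap).
  by split; [exists (mean_gap 0), 0%N|exists e => _ [k _ <-]].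
pose m := inf (range mean_gap).
have m_gt0 : 0 < m.
  apply: lt_le_trans e0 _; apply: lb_le_inf; first exact: hinf.1.
  by move=> _ [k _ <-].
have m_le k : m <= mean_gap k by apply: ge_inf; [exact: hinf.2|exists k].
have c_gt0 : 0 < c by rewrite divr_gt0 ?subr_gt0 // mulr_gt0 // ltr_wpDr.
have K_gt0 := score_bound_gt0; have mean0 := mean_ge0.
(* The tilt at scale [l] is [delta = sigma / l]: over the [l * l] sites the second
   moment of the density stays below [M], while the free energy gained,
   [sigma * c * m / 2] times [l], exceeds the boundary term [40 * mean * l]. *)
have [sigma sigmaE] : exists y, y = (80 * mean + 2) / (c * m) by eexists.
have sigma_gt0 : 0 < sigma.
  by rewrite sigmaE; apply: divr_gt0; [rewrite ltr_wpDl // mulr_ge0|exact: mulr_gt0].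
have [M ME] : exists y, y = expR ((sigma * K) ^+ 2) by eexists.
have M_gt0 : 0 < M by rewrite ME expR_gt0.
(* [theta] makes the second-moment error m / 8; [k] is then taken so close to the infimum that the
   other error is at most m / 8. *)
have [theta thetaE] : exists y, y = m / (4 * M) by eexists.
have theta_gt0 : 0 < theta by rewrite thetaE; apply: divr_gt0 => //; exact: mulr_gt0.
have [_ [k _ <-] hk] : exists2 y, range mean_gap y & y < m + theta * m / 4.
  by apply: inf_adherent => //; rewrite divr_gt0 // mulr_gt0.
pose N0 := #|` box (0, 0) k.+1|.
(* With [l] above [bound], the first summand gives [delta_small], and the second gives
   [N0 * delta * K] at most 1/4, hence the factor 3/4 by Bernoulli's inequality. *)
pose bound := 2 * (sigma * K) + 4 * N0%:R * (sigma * K).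
have sK_gt0 : 0 < sigma * K by rewrite mulr_gt0.
have N0_ge0 : 0 <= 4 * N0%:R :> R by rewrite mulr_ge0.
have [l [lpos kl lb]] : exists l, [/\ (0 < l)%N, (k <= l)%N & bound <= l%:R].
  have b0 : 0 <= bound by apply: addr_ge0; apply: mulr_ge0; rewrite ?(ltW sK_gt0).
  exists (Num.bound bound + k).+1; split => //; first by rewrite leqW // leq_addl.
  apply: le_trans (ltW (archi_boundP b0)) _.
  by rewrite ler_nat leqW // leq_addr.
have l_gt0 : 0 < l%:R :> R by rewrite ltr0n.
have [delta deltaE] : exists y, y = sigma / l%:R by eexists.
have delta_ge0 : 0 <= delta by rewrite deltaE; apply: divr_ge0; exact: ltW.
have dKl : delta * K * l%:R = sigma * K by rewrite deltaE; field; rewrite gt_eqF.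
have delta_small : 2 * delta * K <= 1.
  have e2 : 2 * delta * K * l%:R = 2 * (delta * K * l%:R) by ring.
  rewrite -(ler_pM2r l_gt0) mul1r e2 dKl.
  by apply: le_trans lb; rewrite /bound lerDl; apply: mulr_ge0 => //; exact: ltW.
have dK01 : 0 <= delta * K <= 1.
  have h : 0 <= delta * K by rewrite mulr_ge0 // ltW.
  by rewrite h /=; move: delta_small; lra.
have hpow : 3 / 4 <= (1 - delta * K) ^+ N0.
  apply: le_trans (bernoulli_ineq N0 dK01).
  have : N0%:R * (delta * K) <= 1 / 4.
    rewrite -(ler_pM2r l_gt0) -mulrA dKl; apply: le_trans (_ : bound / 4 <= _); last first.
      by rewrite [leRHS]mulrC mul1r ler_pM2r.
    rewrite /bound; have : 0 <= sigma * K by exact: ltW.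
    by lra.
  by lra.
pose s := even_sites l; pose L := box (0, 0) l.*2.-1.+1.
have hs u : u \in s -> parity u = false /\ u \in core L.
  by rewrite /L core_box; exact: even_sitesP.
have hg u t : u \in s -> uniq t -> {subset t <= s} ->
    m / 2 <= Ex (fun x => gap x L u * density delta t x).
  move=> us ut ts; have [_ uL] := hs _ us.
  have kn : (k <= l.*2.*2)%N by apply: leq_trans kl _; rewrite -!addnn -addnA leq_addr.
  have Lu : (L `<=` box u l.*2.*2.+1)%fset.
    by apply: box_sub_even; rewrite -core_box.
  have := Ex_gap_density delta_ge0 delta_small theta_gt0 ut kn (fun w => core_adj uL) Lu.
  have size_t : (size t <= l * l)%N.
    by rewrite -size_even_sites; exact: uniq_leq_size.
  have h1 : 3 / 4 * m <= (1 - delta * K) ^+ N0 * mean_gap k.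
    by apply: ler_pM => //; exact: ltW.
  have h2 : (2 * theta)^-1 * (mean_gap k - mean_gap l.*2.*2) <= m / 8.
    have -> : m / 8 = (2 * theta)^-1 * (theta * m / 4) by field; rewrite gt_eqF.
    rewrite ler_pM2l ?invr_gt0 ?mulr_gt0 // lerBlDl; apply: (le_trans (ltW hk)).
    by rewrite lerD2r.
  have h3 : theta / 2 * (1 + (delta * K) ^+ 2) ^+ size t <= m / 8.
    have -> : m / 8 = theta / 2 * M by rewrite thetaE; field; rewrite gt_eqF.
    rewrite ler_pM2l ?divr_gt0 //.
    have one : 1 <= 1 + (delta * K) ^+ 2 by rewrite lerDl sqr_ge0.
    apply: le_trans (ler_weXn2l one size_t) _.
    have -> : M = expR ((delta * K) ^+ 2) ^+ (l * l).
      rewrite ME -expRM_natl; congr expR; rewrite -dKl natrM; ring.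
    by apply: lerXn2r; rewrite ?nnegrE ?expR_ge0 ?expR_ge1Dx // (le_trans _ one).
  exact: key h1 h2 h3.
have := free_energy_bound delta_ge0 delta_small (uniq_even_sites l) hs hg.
rewrite size_even_sites => hE.
have hcard : (#|` (L `\` core L)%fset| <= 20 * l)%N := card_boundary_even lpos.
have : 2 * (mean *+ #|` (L `\` core L)%fset|) <= 2 * (mean *+ (20 * l)).
  by rewrite ler_pM2l // ler_wpMn2l.
move=> /(le_trans hE).
have -> : delta * c * (m / 2) *+ (l * l) = (40 * mean + 1) * l%:R.
  rewrite -[LHS]mulr_natr natrM deltaE sigmaE; field.
  by rewrite !gt_eqF // -subr_gt0; have := ab; lra.
have -> : 2 * (mean *+ (20 * l)) = 40 * mean * l%:R.
  by rewrite -[mean *+ _]mulr_natr natrM; ring.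
rewrite ler_pM2r //; lra.
Qed.

(** Markov's inequality: the indicator that all gaps at [v] are at least 1 / (j + 1) is bounded by j
    + 1 times each gap, whose mean can be made arbitrarily small. Countably many sites and
    thresholds suffice. *)
Theorem gap_vanishes_ae : {ae P, forall w, forall v (e : R), 0 < e ->
  exists k, gap_box (field Y w) v k < e}.
Proof.
have key v j : {ae P, forall w, exists k, gap_box (field Y w) v k < j.+1%:R^-1}.
  pose N : set (env R) := \bigcap_k [set x | j.+1%:R^-1 <= gap_box x v k].
  have mN : measurable N.
    apply: bigcapT_measurable => k.
    have := @measurable_gap R (box v k.+1) v measurableT _ (measurable_itv `[j.+1%:R^-1, +oo[).
    by rewrite setTI set_itvE.
  have nN : nice (fun x => \1_N x).
    apply: (nice_bounded (c := 1)); first exact: measurable_indic.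
    by move=> x _; rewrite indicE; case: (_ \in _); rewrite ?lexx ler01.
  have ExN : Ex (fun x => \1_N x) <= 0.
    apply/ler_addgt0Pr => e e0; rewrite add0r.
    have [k hk] := mean_gap_vanishes (divr_gt0 e0 (ltr0n R j.+1 : 0 < j.+1%:R)).
    apply: (@le_trans _ _ (j.+1%:R * mean_gap k)); last first.
      by rewrite [leLHS]mulrC -ler_pdivlMr ?ltr0n // ltW.
    rewrite -(Ex_gap_box v) -ExZ; last exact: nice_gap_box.
    apply: le_Ex => //; first by apply: niceZ => //; exact: nice_gap_box.
    move=> x x0; rewrite indicE; case: (boolP (x \in N)) => [/set_mem|] xN.
      by have := xN k Logic.I; rewrite /= -ler_pdivrMl ?ltr0n // mulr1.
    by rewrite mulr_ge0 // gap_box_ge0.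
  have mpre : measurable (field Y @^-1` N).
    by rewrite -[X in measurable X]setTI; exact: measurable_field.
  exists (field Y @^-1` N); split => //.
    have -> : P (field Y @^-1` N) = (Ex (fun x => \1_N x))%:E.
      rewrite /Ex /Rintegral fineK; last first.
        by have [_ _ iN] := nN; exact: integrable_fin_num.
      have := integral_indic P measurableT mpre; rewrite setIT => <-.
      by apply: eq_integral => w _; rewrite !indicE; congr (_%:R)%:E;
        congr nat_of_bool; apply/idP/idP; rewrite !in_setE.
    by congr EFin; apply/eqP; rewrite eq_le ExN /=; exact: Ex_ge0.
  by move=> w /= nw k _ /=; rewrite leNgt; apply/negP => h; apply: nw; exists k.
have all n j : {ae P, forall w, exists k, gap_box (field Y w) (site n) k < j.+1%:R^-1}.
  exact: key.
have := ae_foralln (fun n => ae_foralln (all n)).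
apply: filterS => w h v e e0.
have e1 : 0 <= e^-1 by rewrite invr_ge0 ltW.
have [k hk] := h (rank v) (Num.bound e^-1); exists k.
rewrite rankK in hk; apply: lt_trans hk _.
rewrite invf_plt ?posrE ?ltr0n //; apply: lt_trans (archi_boundP e1) _.
by rewrite ltr_nat.
Qed.

End tilting.

(** Let c be the supremum of the levels below which [f] has no mass. If c + r were exceeded with
    positive probability for some r > 0, the levels c + r / 2 and c + r would do; otherwise [f]
    equals c almost surely. *)
Lemma nonconstant_levels d (T : measurableType d) (R : realType) (P : probability T R)
    (f : T -> R) : measurable_fun setT f -> (forall w, 0 <= f w) ->
  (forall c, ~ {ae P, forall w, f w = c}) ->
  exists a b : R, [/\ 0 <= a, a < b, (0 < P (f @^-1` [set y | (y <= a)%R]))%E &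
    (0 < P (f @^-1` [set y | (b <= y)%R]))%E].
Proof.
move=> mf f0 nc; apply: contrapT => hab.
have mle a : measurable (f @^-1` [set y | y <= a]).
  by rewrite -set_itvNyc -[X in measurable X]setTI; apply: mf => //; exact: measurable_itv.
have mge b : measurable (f @^-1` [set y | b <= y]).
  by rewrite -set_itvcy -[X in measurable X]setTI; apply: mf => //; exact: measurable_itv.
pose S := [set a : R | P (f @^-1` [set y | y <= a]) = 0%E].
have S_down a a' : a <= a' -> S a' -> S a.
  move=> aa' Sa'; apply/eqP; rewrite -measure_le0 -[leRHS]Sa'.
  by apply: le_measure; rewrite ?inE // => w /= /le_trans; apply.
have S_neg a : a < 0 -> S a.
  move=> a0; rewrite /S /= (_ : _ @^-1` _ = set0) ?measure0 //.
  by apply/seteqP; split => // w /=; rewrite leNgt (lt_le_trans a0 (f0 w)).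
have S_ub : has_ubound S.
  apply: contrapT => nub; have Sn n : S n%:R.
    apply: contrapT => nS; apply: nub; exists n%:R => a Sa.
    by rewrite leNgt; apply/negP => /ltW na; apply: nS; exact: S_down Sa.
  have : P setT = 0%E.
    apply: measure_negligible => //.
    rewrite (_ : setT = \bigcup_n (f @^-1` [set y | y <= n%:R])).
      by apply: negligible_bigcup => n; apply/negligibleP; [exact: mle|exact: Sn].
    apply/seteqP; split => // w _; exists (Num.bound (f w)) => //=.
    exact/ltW/archi_boundP.
  by rewrite probability_setT => /eqP; rewrite onee_eq0.
pose c := sup S.
have S_lt a : a < c -> S a.
  move=> ac; have ca : 0 < c - a by rewrite subr_gt0.
  have S_sup : has_sup S by split => //; exists (-1); apply: S_neg; rewrite ltrN10.
  have [s Ss] := sup_adherent ca S_sup.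
  by rewrite subKr => /ltW as_; exact: S_down Ss.
have c0 : 0 <= c.
  rewrite leNgt; apply/negP => c0.
  have : c / 2 <= c by apply: ub_le_sup => //; apply: S_neg; rewrite pmulr_llt0.
  by lra.
have S_gt a : c < a -> ~ S a.
  by move=> ca Sa; have := ub_le_sup S_ub Sa; rewrite -/c leNgt ca.
apply: (nc c).
have null n : P (f @^-1` [set y | y <= c - n.+1%:R^-1]) = 0%E /\
    P (f @^-1` [set y | c + n.+1%:R^-1 <= y]) = 0%E.
  have : 0 < n.+1%:R^-1 :> R by rewrite invr_gt0 ltr0n.
  move: n.+1%:R^-1 => r r0; split; first by apply: S_lt; rewrite ltrBlDr ltrDl.
  apply/eqP; rewrite -measure_le0 leNgt; apply/negP => h; apply: hab.
  exists (c + r / 2), (c + r); split => //; [lra|lra|].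
  rewrite lt0e measure_ge0 andbT; apply/eqP; apply: S_gt; lra.
exists (\bigcup_n ((f @^-1` [set y | y <= c - n.+1%:R^-1]) `|`
   (f @^-1` [set y | c + n.+1%:R^-1 <= y]))); split.
- by apply: bigcupT_measurable => n; exact: measurableU.
- apply: measure_negligible; first by apply: bigcupT_measurable => n; exact: measurableU.
  apply: negligible_bigcup => n; have [n1 n2] := null n.
  by apply: negligibleU; apply/negligibleP.
- move=> w /= fc; have : 0 < `|f w - c| by rewrite normr_gt0 subr_eq0; exact/eqP.
  set r := `|_| => r0; have r1 : 0 <= r^-1 by rewrite invr_ge0 ltW.
  exists (Num.bound r^-1) => //=.
  have : (Num.bound r^-1).+1%:R^-1 <= r.
    rewrite invf_ple ?posrE ?ltr0n //; apply: le_trans (ltW (archi_boundP r1)) _.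
    by rewrite ler_nat.
  move: (_.+1%:R^-1) => s; rewrite /r; have [h|h] := lerP c (f w).
    by move=> h'; right; lra.
  by move=> h'; left; lra.
Qed.

Theorem theorem1p2 (R : realType) (d : measure_display) (T : measurableType d)
    (P : probability T R) (lambda : R) (X : Z2 -> {RV P >-> R}) :
  0 <= lambda ->
  (forall v, {ae P, forall w, 0 <= X v w}) ->
  mutually_independent X ->
  identically_distributed X ->
  (forall v, ~ as_constant (X v)) ->
  (exists2 eps : R, 0 < eps &
     forall v, ('E_P[fun w => (`|X v w| `^ (2 + eps))%R] < +oo)%E) ->
  {ae P, forall w, gibbs_singleton (fun v => lambda * X v w)}.
Proof.
move=> lambda_ge0 X_ge0 X_ind X_id X_nc [eps eps0 X_mom].
(* For [lambda = 0] the activities are constant, so the random argument does not apply, but the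
   condition on the gaps is trivial. *)
have [lambda0|lambda_neq0] := eqVneq lambda 0.
  apply: aeW => w; apply: uniqueness => [v|v e e0]; first by rewrite lambda0 mul0r.
  by exists 0%N; rewrite lambda0 !mul0r.
have lambda_gt0 : 0 < lambda by rewrite lt0r lambda_neq0.
(* The variables are nonnegative only almost surely. Truncation gives an i.i.d. field nonnegative
   everywhere, equal to the activities off a null set. *)
pose h (y : R) := lambda * Num.max y 0.
have mh : measurable_fun setT h by apply: measurable_funM => //; exact: measurable_maxr.
have h_ge0 y : 0 <= h y by rewrite mulr_ge0 // le_max lexx orbT.
pose Y v w := h (X v w).
have mX v : measurable_fun setT (X v) by [].
have mY v : measurable_fun setT (Y v) by exact: (measurableT_comp mh (mX v)).
have mhB (B : set R) : measurable B -> measurable (h @^-1` B).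
  by move=> mB; rewrite -[X in measurable X]setTI; exact: mh.
have Y_ind (F : {fset Z2}) (B : Z2 -> set R) : (forall v, measurable (B v)) ->
    P (\bigcap_(v in [set` F]) (Y v @^-1` B v)) = (\prod_(v <- F) P (Y v @^-1` B v))%E.
  by move=> mB; exact: (X_ind F (fun v => h @^-1` B v) (fun v => mhB _ (mB v))).
have Y_id u v (B : set R) : measurable B -> P (Y u @^-1` B) = P (Y v @^-1` B).
  by move=> mB; exact: (X_id u v _ (mhB _ mB)).
have Y_ge0 v w : 0 <= Y v w by exact: h_ge0.
have Y_int v : P.-integrable setT (fun w => (Y v w)%:E).
  have int1 : P.-integrable setT (fun w => (`|X v w| `^ (2 + eps))%:E).
    apply/integrableP; split.
      apply/measurable_EFinP; apply: (measurableT_comp (measurable_powR (2 + eps))).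
      exact: measurableT_comp.
    under eq_integral => w _ do rewrite gee0_abs ?lee_fin ?powR_ge0 //.
    by have := X_mom v; rewrite unlock.
  (* The dominating function comes from |x| <= 1 + |x|^(2 + eps). *)
  have int2 := integrableZl measurableT lambda
    (integrableD measurableT (finite_measure_integrable_cst P 1 measurableT) int1).
  apply: (le_integrable measurableT _ _ int2); first exact/measurable_EFinP.
  move=> w _; rewrite /= ger0_norm ?Y_ge0 //.
  rewrite ger0_norm ?mulr_ge0 ?addr_ge0 ?powR_ge0 // lee_fin ler_wpM2l //.
  apply: (@le_trans _ _ `|X v w|).
    by rewrite ge_max normr_ge0 andbT ler_norm.
  have [le1|gt1] := lerP `|X v w| 1.
    by apply: (le_trans le1); rewrite lerDl powR_ge0.
  rewrite -[leLHS]powRr1 //; apply: (@le_trans _ _ (`|X v w| `^ (2 + eps))).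
    by apply: ler_powR; [exact: ltW|lra].
  by rewrite lerDr.
have [|a [b [a0 ab low high]]] := @nonconstant_levels _ _ _ P _ (mY (0, 0)) (Y_ge0 _).
  move=> c hc; apply: (X_nc (0, 0)); exists (c / lambda).
  have := X_ge0 (0, 0); apply: filterS2 hc => w hc Xw.
  by rewrite -hc /Y /h; rewrite (max_idPl Xw) mulrC mulKf.
have [low_gt0 high_gt0] : 0 < prob P Y [set y | y <= a] /\ 0 < prob P Y [set y | b <= y].
  by split; apply: fine_gt0; rewrite (low, high) (le_lt_trans (probability_le1 _ _)) ?ltry //;
    rewrite -[X in measurable X]setTI; apply: mY => //;
    rewrite -(set_itvNyc, set_itvcy); exact: measurable_itv.
have nonneg : {ae P, forall w, forall v, 0 <= X v w}.
  have := ae_foralln (fun n => X_ge0 (site n)); apply: filterS => w Xw v.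
  by rewrite -(rankK v).
have vanish := gap_vanishes_ae mY Y_ind Y_id Y_ge0 a0 ab low_gt0 high_gt0 Y_int.
apply: filterS2 nonneg vanish => w Xw gap0.
rewrite (_ : (fun v => lambda * X v w) = field Y w); last first.
  by apply/funext => v; rewrite /field /Y /h (max_idPl (Xw v)).
apply: uniqueness => [v|v e e0]; first exact: Y_ge0.
(* The activity may vanish, so [e] is divided by the activity plus 1. *)
have l0 : 0 < field Y w v + 1 by rewrite ltr_wpDl ?Y_ge0.
have [k hk] := gap0 v (e / (field Y w v + 1)) (divr_gt0 e0 l0).
exists k; rewrite ltr_pdivlMr // in hk; apply: le_lt_trans hk.
rewrite mulrC ler_wpM2l ?lerDl ?ler01 //; apply: gap_box_ge0 => u; exact: Y_ge0.
Qed.
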